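(* Let $K_{16}$ be the set of real $16\times 16$ matrices $A=(a_{ij})$ with nonnegative entries whose entries sum to $16$. For $A\in K_{16}$ let $r_i=\sum_{j=1}^{16}a_{ij}$ and $c_j=\sum_{i=1}^{16}a_{ij}$ denote its row and column sums, and let $$\Phi(A)=\prod_{i=1}^{16} r_i+\prod_{j=1}^{16} c_j-\operatorname{per}(A).$$ Then for every $A\in K_{16}$, $$\Phi(A)\le 2-\frac{16!}{16^{16}},$$ with equality if and only if $A=U_{16}$, where $U_{16}$ is the $16\times 16$ matrix all of whose entries equal $1/16$.
   Context: $\operatorname{per}(A)=\sum_{\pi\in S_n}\prod_{i=1}^n a_{i\pi(i)}$ denotes the permanent of an $n\times n$ matrix $A=(a_{ij})$. *)

(* Defs.v *)
From mathcomp Require Import all_boot all_order all_algebra all_fingroup.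
From mathcomp Require Import reals.

Set Implicit Arguments.
Unset Strict Implicit.
Unset Printing Implicit Defensive.

Import Order.TTheory GRing.Theory Num.Theory.
Local Open Scope ring_scope.

Definition per (R : realType) (n : nat) (A : 'M[R]_n) : R :=
  \sum_(s : 'S_n) \prod_(i < n) A i (s i).

Definition rowsum (R : realType) (n : nat) (A : 'M[R]_n) (i : 'I_n) : R :=
  \sum_(j < n) A i j.

Definition colsum (R : realType) (n : nat) (A : 'M[R]_n) (j : 'I_n) : R :=
  \sum_(i < n) A i j.

Definition K (R : realType) (n : nat) (A : 'M[R]_n) : Prop :=
  (forall i j, 0 <= A i j) /\ \sum_(i < n) \sum_(j < n) A i j = n%:R.

Definition Phi (R : realType) (n : nat) (A : 'M[R]_n) : R :=
  \prod_(i < n) rowsum A i + \prod_(j < n) colsum A j - per A.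

Definition U (R : realType) (n : nat) : 'M[R]_n := const_mx (1 / n%:R).

(* Main.v *)
Require Import Defs.
From mathcomp Require Import boolp classical_sets topology normedtype derive.
From mathcomp Require Import sequences exp complex polyrcf.
From mathcomp Require Import all_boot all_order all_algebra all_fingroup.
From mathcomp Require Import reals.
From mathcomp Require Import ring lra zify.

Set Implicit Arguments.
Unset Strict Implicit.
Unset Printing Implicit Defensive.

Import Order.TTheory GRing.Theory Num.Theory.
Local Open Scope ring_scope.

(** The functional has a maximizer A on the compact set K, and the point is to
    show that every maximizer is the uniform matrix.  Write p for the permanent
    of A, r and c for its row and column sums, eps = 16! / 16^16.

    Since the products of the r i and of the c j are at most 1, comparison with
    the uniform matrix shows that p is at most eps, about 10^-6, and that both
    products are within eps of 1.  Differentiating in each entry (gradient_le,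
    gradient_eq) gives minor A i j >= p + X i - Z j, with equality where
    A i j > 0, for potentials X i and Z j that vanish exactly when the sums r i
    and c j equal 1.

    Suppose that the potentials are not all equal.  Expanding p along rows and
    columns shows that they are almost harmonic on the bipartite graph weighted
    by A: their Dirichlet energy is of the order of p times their variance
    (energyE).  Cutting the 32 potentials at their largest gap g therefore leaves
    A almost block diagonal, with square blocks of sizes k and 16 - k
    (card_IJ), and the first-order conditions give g <= p (gap_le).  The
    permanent of a block diagonal doubly stochastic matrix is at least
    k! (16-k)! / (k^k (16-k)^(16-k)), which is at least 2 eps, and A is close to
    such a matrix.  To make this
    quantitative, the doubly stochastic matrix to compare A with is the matrix of
    normalized products of the entries of A with the minors of its block part;
    the first-order conditions compare it with A, and the cost of the comparison
    is again bounded by the energy (gap_cut_absurd).  So p > eps, which is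
    absurd; hence the potentials are equal, hence zero, and A is doubly
    stochastic.

    For a doubly stochastic maximizer Egorychev's argument applies: the
    first-order conditions say that all minors are at least p, with equality
    where A i j > 0, and the Alexandrov inequality then makes all minors equal
    (minor_const).  So averaging two rows yields another maximizer, and averaging
    all rows but one as much as possible shows that the remaining row is uniform
    (maximizer_row_uniform).

    The permanental inequalities rest on stability: a permanent in which some
    rows equal a vector z and the others are positive does not vanish when all
    coordinates of z are in the upper half plane (permanent_stable).  This gives
    the Alexandrov inequality, and the latter suffices for Gurvits' capacity
    proof of van der Waerden's bound and of its version for two blocks (capacity,
    capacity_blocks). *)

(** * Permanents as functions of their rows *)

Section PermanentAlgebra.
Variables (F : comPzRingType) (T : finType).
Implicit Types (a : T -> T -> F) (v w : T -> F) (S : {set T}) (i j k : T).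

Definition permanent a : F := \sum_(s : {perm T}) \prod_i a i (s i).

Definition set_row a i v : T -> T -> F := fun k => if k == i then v else a k.

Definition set_rows S v a : T -> T -> F := fun k => if k \in S then v else a k.

(** The permanent of the array without row i and column j.  Summing over the
    permutations of the whole index type that send i to j keeps every minor on
    the index type of the array itself. *)
Definition minor a i j : F :=
  \sum_(s : {perm T} | s i == j) \prod_(k | k != i) a k (s k).

Lemma eq_permanent a b : (forall i j, a i j = b i j) -> permanent a = permanent b.
Proof.
by move=> ab; apply: eq_bigr => s _; apply: eq_bigr => i _; rewrite ab.
Qed.

Lemma permanent_minor a i : permanent a = \sum_j a i j * minor a i j.
Proof.
rewrite /permanent (partition_big (fun s : {perm T} => s i) predT) //=.
apply: eq_bigr => j _; rewrite /minor mulr_sumr; apply: eq_bigr => s /eqP sij.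
by rewrite (bigD1 i) //= sij.
Qed.

Lemma minor_row a i v j : minor (set_row a i v) i j = minor a i j.
Proof.
apply: eq_bigr => s _; apply: eq_bigr => k ki.
by rewrite /set_row (negPf ki).
Qed.

Lemma permanent_row a i v : permanent (set_row a i v) = \sum_j v j * minor a i j.
Proof.
rewrite (permanent_minor _ i); apply: eq_bigr => j _.
by rewrite minor_row /set_row eqxx.
Qed.

(** Together with the expansion along rows this says that the products
    a i j * minor a i j, divided by the permanent, form a doubly stochastic
    array. *)
Lemma permanent_minor_col a j : permanent a = \sum_i a i j * minor a i j.
Proof.
rewrite /permanent (partition_big (fun s : {perm T} => (s^-1)%g j) predT) //=.
apply: eq_bigr => i _; rewrite /minor mulr_sumr.
have E (s : {perm T}) : ((s^-1)%g j == i) = (s i == j).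
  by apply/eqP/eqP => <-; rewrite ?permKV ?permK.
rewrite (eq_bigl _ _ E); apply: eq_bigr => s /eqP sij.
by rewrite (bigD1 i) //= sij.
Qed.

Lemma permanent_rowD a i v w (c : F) :
  permanent (set_row a i (fun j => v j + c * w j)) =
  permanent (set_row a i v) + c * permanent (set_row a i w).
Proof.
rewrite !permanent_row mulr_sumr -big_split; apply: eq_bigr => j _ /=.
by rewrite mulrDl mulrA.
Qed.

Lemma permanent_row_id a i : permanent (set_row a i (a i)) = permanent a.
Proof. by apply: eq_permanent => k j; rewrite /set_row; case: eqP => [->|]. Qed.

Lemma permanent_row_perm a (t : {perm T}) : permanent (fun i => a (t i)) = permanent a.
Proof.
rewrite /permanent (reindex_inj (mulgI t)) /=; apply: eq_bigr => s _.
rewrite [RHS](reindex_inj (@perm_inj _ t)) /=.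
by apply: eq_bigr => i _; rewrite permM.
Qed.

Lemma permanent_rowC a i k v w : i != k ->
  permanent (set_row (set_row a i v) k w) = permanent (set_row (set_row a i w) k v).
Proof.
move=> ik; rewrite -[RHS](permanent_row_perm _ (tperm i k)); apply: eq_permanent => h j.
rewrite /set_row; case: (tpermP i k h) => [->|->|hi hk].
- by rewrite (negPf ik) !eqxx.
- by rewrite eqxx (negPf ik) eqxx.
- by move/eqP: hi => hi; move/eqP: hk => hk; rewrite (negPf hi) (negPf hk).
Qed.

End PermanentAlgebra.

Lemma rmorph_permanent (F G : comPzRingType) (f : {rmorphism F -> G}) (T : finType)
    (a : T -> T -> F) : f (permanent a) = permanent (fun i j => f (a i j)).
Proof.
by rewrite rmorph_sum; apply: eq_bigr => s _; rewrite rmorph_prod.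
Qed.

Section PermanentOrder.
Variables (R : numDomainType) (T : finType).
Implicit Types (a b : T -> T -> R).

Lemma permanent_ge0 a : (forall i j, 0 <= a i j) -> 0 <= permanent a.
Proof. by move=> a0; apply: sumr_ge0 => s _; apply: prodr_ge0. Qed.

Lemma permanent_gt0 a : (forall i j, 0 < a i j) -> 0 < permanent a.
Proof.
move=> a0; rewrite /permanent (bigD1 1%g) //=; apply: ltr_pwDl.
  by apply: prodr_gt0.
by apply: sumr_ge0 => s _; apply: prodr_ge0 => i _; apply: ltW.
Qed.

Lemma ler_permanent a b :
  (forall i j, 0 <= a i j <= b i j) -> permanent a <= permanent b.
Proof.
by move=> ab; apply: ler_sum => s _; apply: ler_prod => i _; apply: ab.
Qed.

Lemma minor_ge0 a i j : (forall i j, 0 <= a i j) -> 0 <= minor a i j.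
Proof. by move=> a0; apply: sumr_ge0 => s _; apply: prodr_ge0. Qed.

End PermanentOrder.

(** * Stability and the Alexandrov inequality *)

(** Gives the top coefficient of a product of linear factors, so that a sum of
    such products with positive top coefficients is seen not to be constant. *)
Lemma size_coef_prod_linear (F : comNzRingType) (I : Type) (r : seq I) (c d : I -> F) :
  (size (\prod_(k <- r) ((c k)%:P + d k *: 'X))%R <= (size r).+1)%N /\
  (\prod_(k <- r) ((c k)%:P + d k *: 'X))`_(size r) = \prod_(k <- r) d k.
Proof.
elim: r => [|k r [IHs IHc]]; first by rewrite !big_nil size_poly1 coef1.
rewrite !big_cons /=; set q := \prod_(k <- r) _ in IHs IHc *.
have H n : (((c k)%:P + d k *: 'X) * q)`_n.+1 = c k * q`_n.+1 + d k * q`_n.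
  by rewrite mulrDl coefD coefCM -scalerAl coefZ coefXM.
split; last by rewrite H IHc nth_default // mulr0 add0r.
by apply/leq_sizeP => -[//|n] nr; rewrite H !nth_default ?mulr0 ?addr0 //;
  apply: leq_trans IHs _ => //; apply: ltnW.
Qed.

Lemma deriv_permanent (F : comNzRingType) (T : finType) (b : T -> T -> {poly F}) :
  (permanent b)^`() = \sum_k permanent (set_row b k (fun j => (b k j)^`())).
Proof.
rewrite /permanent raddf_sum /= exchange_big /=; apply: eq_bigr => s _.
have H (r : seq T) : uniq r -> (\prod_(i <- r) b i (s i))^`() =
    \sum_(k <- r) \prod_(i <- r) set_row b k (fun j => (b k j)^`()) i (s i).
  elim: r => [|x r IH] /=; first by rewrite !big_nil derivC.
  case/andP=> xr ur; rewrite !big_cons derivM IH //.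
  have -> : set_row b x (fun j => (b x j)^`()) x (s x) = (b x (s x))^`().
    by rewrite /set_row eqxx.
  congr (_ * _ + _).
    rewrite !big_seq; apply: eq_bigr => i ir; rewrite /set_row.
    by case: eqP xr => // <-; rewrite ir.
  rewrite mulr_sumr !big_seq; apply: eq_bigr => k kr.
  rewrite big_cons; congr (_ * _); rewrite /set_row; case: eqP => // xk.
  by rewrite xk kr in xr.
by apply: H; rewrite /index_enum -enumT enum_uniq.
Qed.

Section Stability.
Variable R : rcfType.
Local Notation C := R[i].
Local Notation toC := (real_complex R).
Local Notation Im := complex.Im.

(** At a point where p does not vanish, p' / p is the sum of the 1 / (w - x)
    over the roots x.  If all roots lie in the lower half plane, each term at
    w = 0 is - 1 / x and has negative imaginary part, so p' cannot vanish there
    unless there are no roots at all. *)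
Lemma gauss_lucas0 (p : {poly C}) :
  (forall w, 0 <= Im w -> p.[w] != 0) -> p^`().[0] = 0 -> (size p <= 1)%N.
Proof.
have [r ->] := closed_field_poly_normal p => p0.
have c0 : lead_coef p != 0.
  by apply/eqP => c0; move: (p0 0 (lexx _)); rewrite c0 scale0r horner0 eqxx.
have {p0} rlt : forall x, x \in r -> Im x < 0.
  move=> x xr; rewrite ltNge; apply: contraL xr => /p0; apply: contra => xr.
  by rewrite hornerZ -/(root _ x) mulf_eq0 -/(root _ x) root_prod_XsubC xr orbT.
rewrite derivZ hornerZ => /eqP; rewrite mulf_eq0 (negPf c0) /= => /eqP d0.
have H (s : seq C) : (forall x, x \in s -> Im x < 0) ->
  exists t : C, (\prod_(z <- s) ('X - z%:P))^`().[0] =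
     t * (\prod_(z <- s) ('X - z%:P)).[0] /\
     (if s is [::] then t = 0 else Im t < 0).
  elim: s => [|x s IH] sl; first by exists 0; rewrite big_nil derivC horner0 mul0r.
  have [|t [tE t0]] := IH; first by move=> y ys; apply: sl; rewrite inE ys orbT.
  have x0 : Im x < 0 by apply: sl; rewrite inE eqxx.
  have xn0 : x != 0 by apply: contraTneq x0 => ->; rewrite /= ltxx.
  exists (t - x^-1); rewrite big_cons derivM !hornerE /= tE; split.
    rewrite derivB derivX derivC !hornerE /=.
    set q := (\prod_(j <- s) _).[0].
    have aux (u v w : R[i]) : u != 0 -> 
      (1 - 0) * w + - u * v * w = (v - u^-1) * - u * w by move=> u0; field.
    exact: aux.
  have xi : 0 < Im x^-1.
    case: (x) x0 xn0 => u v /= v0 _.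
    rewrite -mulNr divr_gt0 ?oppr_gt0 //.
    by rewrite ltr_wpDl ?sqr_ge0 // lt_def sqr_ge0 expf_neq0 //= lt_eqF.
  have -> : Im (t - x^-1) = Im t - Im x^-1 by case: (t); case: (x^-1).
  have : Im t <= 0 by case: (s) t0 => [->|? ? /ltW].
  by move: xi; lra.
have [t [tE t0]] := H r rlt.
case: r rlt t0 tE d0 {H} => [|x r] rlt t0 tE d0.
  by rewrite big_nil; apply: leq_trans (size_scale_leq _ _) _; rewrite size_poly1.
move: t0; rewrite d0 in tE; move/eqP: tE; rewrite eq_sym mulf_eq0.
rewrite -/(root _ 0) root_prod_XsubC => /orP[/eqP -> /=|/rlt /=]; rewrite ?ltxx //.
Qed.

Variables (T : finType) (a : T -> T -> R).
Hypothesis a_gt0 : forall i j, 0 < a i j.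

(** The product of the coordinates does not vanish on the product of upper half
    planes, and replacing one more copy of z by a positive row is, up to a
    factor, a derivative in the direction of that row.  Such derivatives keep
    the nonvanishing by the Gauss-Lucas argument, whence an induction on the
    number of rows that are still equal to z. *)
Lemma permanent_stable (S : {set T}) (z : T -> C) : (forall j, 0 < Im (z j)) ->
  permanent (set_rows S z (fun i j => toC (a i j))) != 0.
Proof.
set aC := fun i j => toC (a i j).
have [n] := ubnP #|~: S|; elim: n S z => // n IH S z + z0.
have [->|] := eqVneq S setT.
  move=> _; have -> : permanent (set_rows setT z aC) = #|{perm T}|%:R * \prod_j z j.
    rewrite /permanent mulr_natl -sumr_const; apply: eq_big => // s _.
    rewrite [RHS](reindex_inj (@perm_inj _ s)) /=.
    by apply: eq_bigr => i _; rewrite /set_rows inE.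
  rewrite mulf_neq0 //.
    by rewrite pnatr_eq0 -lt0n; apply/card_gt0P; exists 1%g.
  by apply/prodf_neq0 => j _; apply: contraTneq (z0 j) => ->; rewrite /= ltxx.
rewrite -subTset => /subsetPn[i _ iS] cS.
pose S1 := i |: S.
pose F : {poly C} := permanent (set_rows S1 (fun j => (z j)%:P + aC i j *: 'X)
                              (fun k j => (aC k j)%:P)).
have Fhor w : F.[w] = permanent (set_rows S1 (fun j => z j + aC i j * w) aC).
  rewrite -[LHS]/(horner_eval w F) rmorph_permanent; apply: eq_permanent => k j.
  by rewrite /set_rows; case: ifP => _; rewrite /= /horner_eval !hornerE.
have F0 w : 0 <= Im w -> F.[w] != 0.
  move=> w0; rewrite Fhor; apply: IH.
    rewrite -ltnS; apply: leq_trans cS; rewrite ltnS proper_card // properE.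
    rewrite setCS subsetUr /= setCS; apply/subsetPn; exists i => //.
    by rewrite setU11.
  move=> j; rewrite /aC.
  have -> : Im (z j + toC (a i j) * w) = Im (z j) + a i j * Im w.
    by case: (z j) => ? ?; case: w {w0} => ? ? /=; ring.
  by rewrite ltr_pwDl // mulr_ge0 // ltW.
(* Each of the #|S1| choices of the row to differentiate gives the same
   permanent, because the rows can be permuted. *)
have Fd : F^`().[0] = #|S1|%:R * permanent (set_rows S z aC).
  rewrite /F deriv_permanent horner_sum mulr_natl -sumr_const [RHS]big_mkcond /=.
  apply: eq_bigr => k _; rewrite -[LHS]/(horner_eval 0 _) rmorph_permanent.
  case: ifPn => kS; last first.
    rewrite (permanent_minor _ k) big1 // => j _.
    by rewrite /set_row eqxx /set_rows (negPf kS) /= derivC raddf0 mul0r.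
  rewrite -[RHS](permanent_row_perm _ (tperm i k)); apply: eq_permanent => h j.
  rewrite /set_row /set_rows; case: eqP => [->|hk].
    rewrite tpermR (negPf iS) kS /= /horner_eval derivD derivC derivZ derivX.
    by rewrite !hornerE.
  case: tpermP => [hi|/hk//|hi _].
    rewrite hi setU11 /= /horner_eval !hornerE ?mulr0 ?addr0.
    by move: kS hk; rewrite hi !inE => /orP[/eqP ->//|->].
  rewrite !inE; move/eqP: hi => /negPf -> /=.
  by case: ifP => _; rewrite /= /horner_eval !hornerE ?mulr0 ?addr0.
have [Fd0|] := eqVneq (F^`().[0]) 0; last first.
  by rewrite Fd; apply: contraNneq => ->; rewrite mulr0.
have := gauss_lucas0 F0 Fd0; apply: contraTneq => _.
have [m Sm] : exists m, #|S1| = m.+1 by exists #|S|; rewrite cardsU1 iS.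
rewrite -ltnNge; apply: contraTltn isT => sF.
have : F`_m.+1 = toC (permanent (set_rows S1 (a i) a)).
  rewrite -Sm /F /permanent coef_sum rmorph_sum; apply: eq_bigr => s _.
  have [_] := size_coef_prod_linear (enum S1) (fun k => z (s k)) (fun k => aC i (s k)).
  rewrite -cardE !big_enum /= => co.
  rewrite rmorph_prod (bigID (mem S1)) [RHS](bigID (mem S1)) /=.
  have -> : \prod_(k | k \notin S1) set_rows S1 (fun j => (z j)%:P + aC i j *: 'X)
     (fun k j => (aC k j)%:P) k (s k) = (\prod_(k | k \notin S1) aC k (s k))%:P.
    by rewrite rmorph_prod; apply: eq_bigr => k kS; rewrite /set_rows (negPf kS).
  rewrite coefMC; congr (_ * _).
    under eq_bigr => k kS do rewrite /set_rows kS.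
    by rewrite co; apply: eq_bigr => k kS; rewrite /set_rows kS.
  by apply: eq_bigr => k kS; rewrite /set_rows (negPf kS).
rewrite nth_default ?(leq_trans sF) // => /esym/eqP.
by rewrite -(rmorph0 toC) (inj_eq (@complexI _)) gt_eqF // permanent_gt0 // => k j;
  rewrite /set_rows; case: ifP.
Qed.
End Stability.

Lemma permanent_quadratic (F : comPzRingType) (T : finType) (a : T -> T -> F) i k
    (x y : T -> F) (c : F) : i != k ->
  let z := fun j => x j + c * y j in
  permanent (set_row (set_row a i z) k z) =
  permanent (set_row (set_row a i x) k x) + 2 * c * permanent (set_row (set_row a i x) k y)
  + c ^+ 2 * permanent (set_row (set_row a i y) k y).
Proof.
move=> ik z; rewrite /z permanent_rowD -/z.
have E v : permanent (set_row (set_row a i z) k v) =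
    permanent (set_row (set_row a i x) k v) + c * permanent (set_row (set_row a i y) k v).
  by rewrite permanent_rowC // /z permanent_rowD !(permanent_rowC _ v _ ik) //;
    rewrite permanent_rowC.
by rewrite !E (permanent_rowC a y x ik); ring.
Qed.

(** Lets a polynomial inequality for small positive perturbations pass to the
    limit. *)
Lemma horner0_ge0 (R : rcfType) (q : {poly R}) (d : R) : 0 < d ->
  (forall e, 0 < e < d -> 0 <= q.[e]) -> 0 <= q.[0].
Proof.
move=> d0 q0; rewrite leNgt; apply/negP => qlt.
have [|d' d'0 dP] := @poly_cont R 0 q (- q.[0]); first by rewrite oppr_gt0.
pose e := Num.min d d' / 2.
have m0 : 0 < Num.min d d' by rewrite lt_min d0.
have e0 : 0 < e by rewrite divr_gt0.
have em : e < Num.min d d' by rewrite /e; move: m0; lra.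
move: em; rewrite lt_min => /andP[ed ed'].
have := dP e; rewrite subr0 gtr0_norm // => /(_ ed').
have q2 : 0 <= q.[e] by apply: q0; rewrite e0.
rewrite ger0_norm; last by rewrite subr_ge0 (le_trans (ltW qlt)).
by move: q2; lra.
Qed.

Section AlexandrovFenchel.
Variables (R : rcfType) (T : finType).
Local Notation toC := (real_complex R).
Implicit Types (a : T -> T -> R) (x y : T -> R).

(** The permanent with rows x + t y at the places i and k is the quadratic
    V0 + 2 t V1 + t^2 V2.  Were its discriminant negative, it would have a root t
    in the upper half plane; then x + t y has positive imaginary parts and
    contradicts stability. *)
Lemma alexandrov_gt0 a x y i k : (forall i j, 0 < a i j) -> (forall j, 0 < y j) ->
  i != k ->
  permanent (set_row (set_row a i x) k x) * permanent (set_row (set_row a i y) k y)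
    <= permanent (set_row (set_row a i x) k y) ^+ 2.
Proof.
move=> a0 y0 ik; rewrite leNgt; apply/negP.
set V0 := permanent (set_row (set_row a i x) k x).
set V1 := permanent (set_row (set_row a i x) k y).
set V2 := permanent (set_row (set_row a i y) k y) => lt.
have V2p : 0 < V2.
  by apply: permanent_gt0 => h j; rewrite /set_row; case: eqP => // _; case: eqP.
pose s := Num.sqrt (V0 * V2 - V1 ^+ 2).
have s0 : 0 < s by rewrite sqrtr_gt0 subr_gt0.
have s2 : s ^+ 2 = V0 * V2 - V1 ^+ 2 by rewrite sqr_sqrtr // subr_ge0 ltW.
(* The root of V0 + 2 t V1 + t ^ 2 V2 in the upper half plane. *)
pose t : R[i] := Complex (- V1 / V2) (s / V2).
pose z j := toC (x j) + t * toC (y j).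
have := @permanent_stable R T a a0 [set i; k] z.
have zIm j : 0 < complex.Im (z j).
  by rewrite /= add0r mulr0 add0r mulr_gt0 // divr_gt0.
move=> /(_ zIm); apply/negP/negPn.
rewrite (_ : permanent _ = permanent (set_row (set_row (fun i j => toC (a i j)) i z) k z)); last first.
  apply: eq_permanent => h j; rewrite /set_rows /set_row !inE.
  by case: (h == k); case: (h == i).
rewrite permanent_quadratic //.
have E v w : permanent (set_row (set_row (fun i j => toC (a i j)) i (fun j => toC (v j)))
     k (fun j => toC (w j))) = toC (permanent (set_row (set_row a i v) k w)).
  rewrite rmorph_permanent; apply: eq_permanent => h j.
  by rewrite /set_row; case: (h == k); case: (h == i).
rewrite !E -/V0 -/V1 -/V2 eq_complex /=; apply/andP; split; apply/eqP.
  have V2n : V2 != 0 by rewrite gt_eqF.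
  have -> : V0 = (s ^+ 2 + V1 ^+ 2) / V2 by rewrite s2; field.
  by field.
by field; rewrite gt_eqF.
Qed.

(** The boundary case, by adding e > 0 to all entries and letting e tend to 0. *)
Lemma alexandrov a x y i k : (forall i j, 0 <= a i j) ->
  (forall j, 0 <= x j) -> (forall j, 0 <= y j) -> i != k ->
  permanent (set_row (set_row a i x) k x) * permanent (set_row (set_row a i y) k y)
    <= permanent (set_row (set_row a i x) k y) ^+ 2.
Proof.
move=> a0 x0 y0 ik.
pose pX (c : R) : {poly R} := c%:P + 'X.
pose A h j := pX (a h j); pose X j := pX (x j); pose Y j := pX (y j).
pose q : {poly R} := permanent (set_row (set_row A i X) k Y) ^+ 2 -
  permanent (set_row (set_row A i X) k X) * permanent (set_row (set_row A i Y) k Y).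
have E e v w : (permanent (set_row (set_row A i (fun j => pX (v j))) k (fun j => pX (w j)))).[e] =
    permanent (set_row (set_row (fun h j => a h j + e) i (fun j => v j + e)) k (fun j => w j + e)).
  rewrite -[LHS]/(horner_eval e _) rmorph_permanent; apply: eq_permanent => h j.
  by rewrite /set_row; case: (h == k); [|case: (h == i)]; rewrite /= /horner_eval !hornerE.
have qE e : q.[e] = permanent (set_row (set_row (fun h j => a h j + e) i (fun j => x j + e))
     k (fun j => y j + e)) ^+ 2 -
   permanent (set_row (set_row (fun h j => a h j + e) i (fun j => x j + e)) k (fun j => x j + e)) *
   permanent (set_row (set_row (fun h j => a h j + e) i (fun j => y j + e)) k (fun j => y j + e)).
  by rewrite /q !hornerE !E.
have /(horner0_ge0 ltr01) : forall e, 0 < e < 1 -> 0 <= q.[e].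
  move=> e /andP[e0 _]; rewrite qE subr_ge0 alexandrov_gt0 // => *; exact: ltr_wpDl.
have Z v w : permanent (set_row (set_row (fun h j => a h j + 0) i (fun j => v j + 0)) k (fun j => w j + 0))
    = permanent (set_row (set_row a i v) k w).
  by apply: eq_permanent => h j; rewrite /set_row; case: (h == k); [|case: (h == i)]; rewrite addr0.
by rewrite qE !Z subr_ge0.
Qed.

End AlexandrovFenchel.

(** * Lower bounds for permanents by capacity *)

Definition row_comb (R : pzRingType) (T : finType) (a : T -> T -> R) (S : {set T})
    (x : T -> R) : T -> R := fun j => \sum_(k in S) x k * a k j.

Section Capacity.
Variables (R : rcfType) (T : finType).
Implicit Types (a : T -> T -> R) (x y v : T -> R) (S U : {set T}).

(** Let N and D be the permanents with v, respectively y, at row i, the rows of S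
    being partly u = y + t v and partly y.  The Alexandrov inequality says that
    N / D can only decrease when one more y becomes u, while D is multiplied by
    1 + t N / D.  Hence the permanent with all rows equal to u grows at most
    geometrically in the number of rows, at the initial rate. *)
Lemma permanent_rows_growth a S i y v t : (forall k j, 0 < a k j) ->
  (forall j, 0 < y j) -> (forall j, 0 < v j) -> i \notin S -> 0 < t ->
  permanent (set_rows S (fun j => y j + t * v j) (set_row a i (fun j => y j + t * v j))) <=
  permanent (set_rows S y (set_row a i y)) *
  (1 + t * (permanent (set_rows S y (set_row a i v)) /
            permanent (set_rows S y (set_row a i y)))) ^+ #|S|.+1.
Proof.
move=> a0 y0 v0 iS t0; set u := fun j => y j + t * v j.
set V0 := permanent (set_rows S y (set_row a i y)); set phi := _ / V0.
pose M U w := set_row (set_rows U u (set_rows S y a)) i w.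
have ik k : k \in S -> i != k by apply: contraTneq => <-.
have ME w : permanent (set_rows S y (set_row a i w)) = permanent (M set0 w).
  apply: eq_permanent => h j; rewrite /M /set_rows /set_row inE.
  by case: eqP => [->|//]; rewrite (negPf iS).
have u0 j : 0 < u j by rewrite addr_gt0 // mulr_gt0.
have M0 U w : (forall j, 0 < w j) -> forall h j, 0 < M U w h j.
  by move=> w0 h j; rewrite /M /set_row /set_rows; do 3?case: ifP => //.
have V00 : 0 < V0 by rewrite /V0 ME permanent_gt0 //; exact: M0.
have phi0 : 0 < phi by rewrite divr_gt0 // ME permanent_gt0 //; exact: M0.
have MU k U w z : k \in S -> k \notin U ->
    permanent (M (k |: U) w) = permanent (set_row (set_row (M U z) i w) k u).
  move=> kS kU; apply: eq_permanent => h j; rewrite /M /set_row /set_rows !inE.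
  have [->|hk] := eqVneq h k; first by rewrite eq_sym (negPf (ik k kS)).
  by case: ifP => //=; case: ifP.
have MU' k U w z : k \in S -> k \notin U ->
    permanent (M U w) = permanent (set_row (set_row (M U z) i w) k y).
  move=> kS kU; apply: eq_permanent => h j; rewrite /M /set_row /set_rows.
  have [->|hk] := eqVneq h k; first by rewrite eq_sym (negPf (ik k kS)) (negPf kU) kS.
  by case: ifP.
have key U : U \subset S -> permanent (M U v) <= phi * permanent (M U y) /\
    permanent (M U y) <= V0 * (1 + t * phi) ^+ #|U|.
  have [n] := ubnP #|U|; elim: n U => // n IH U Un US.
  have [->|[k kU]] := set_0Vmem U.
    by rewrite -!ME cards0 expr0 mulr1 divfK ?gt_eqF.
  have kS := subsetP US k kU.
  set W := U :\ k; have kW : k \notin W by rewrite !inE eqxx.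
  have UE : U = k |: W by rewrite setD1K.
  have cU : #|U| = #|W|.+1 by rewrite UE cardsU1 kW.
  have [||N1 D1] := IH W.
  - by rewrite -ltnS -cU.
  - by apply: subset_trans US; rewrite UE subsetUr.
  have ND := N1; move: N1 D1.
  set N := permanent (M W v); set D := permanent (M W y) => N1 D1.
  have DE : permanent (M U y) = D + t * N.
    rewrite UE (MU k W y y) // /u permanent_rowD -MU' //; congr (_ + t * _).
    by rewrite permanent_rowC ?ik // -MU'.
  have NE : permanent (M U v) = N + t * permanent (set_row (set_row (M W y) i v) k v).
    by rewrite UE (MU k W v y) // /u permanent_rowD -MU'.
  (* This is the decrease of N / D: the cross terms in t cancel. *)
  have AF : permanent (set_row (set_row (M W y) i v) k v) * D <= N ^+ 2.
    rewrite /D /N (MU' k W y y) // (MU' k W v y) //.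
    by apply: alexandrov_gt0; rewrite ?ik //; exact: M0.
  have D0 : 0 < D by apply: permanent_gt0; exact: M0.
  have N0 : 0 < N by apply: permanent_gt0; exact: M0.
  rewrite DE NE cU exprSr; split; last first.
    apply: (@le_trans _ _ (D * (1 + t * phi))).
      by rewrite mulrDr mulr1 lerD2l mulrCA ler_pM2l // mulrC.
    by rewrite [leRHS]mulrA ler_pM2r // addr_gt0 // mulr_gt0.
  rewrite mulrDr lerD // mulrCA ler_pM2l // -(ler_pM2r D0).
  by apply: le_trans AF _; rewrite expr2 mulrAC ler_pM2r.
have [NS DS] := key S (subxx S).
have -> : permanent (set_rows S u (set_row a i u)) = permanent (M S u).
  apply: eq_permanent => h j; rewrite /M /set_rows /set_row.
  by case: eqP => [->|_]; [rewrite (negPf iS)|case: ifP].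
rewrite /M /u permanent_rowD -/(M S y) -/(M S v) exprSr mulrA.
apply: (@le_trans _ _ (permanent (M S y) * (1 + t * phi))).
  by rewrite mulrDr mulr1 lerD2l mulrCA ler_pM2l // mulrC.
by rewrite ler_pM2r // addr_gt0 // mulr_gt0.
Qed.

(** One step of Gurvits' capacity argument.  The hypothesis bounds from below the
    permanent with rows u = y + t a_i, and permanent_rows_growth bounds it from
    above by V0 (1 + t N0 / V0)^m; comparing the two at the t minimizing
    (1 + t N0 / V0)^m / t bounds N0. *)
Lemma capacity_step a S i (K : R) : (forall k j, 0 < a k j) ->
  i \notin S -> S != set0 ->
  (forall x, (forall k, 0 < x k) ->
    K * #|i |: S|%:R ^+ #|i |: S| * \prod_(k in i |: S) x k
      <= permanent (set_rows (i |: S) (row_comb a (i |: S) x) a)) ->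
  forall x, (forall k, 0 < x k) ->
    K * #|S|%:R ^+ #|S| * \prod_(k in S) x k <= permanent (set_rows S (row_comb a S x) a).
Proof.
move=> a0 iS Sn0 H x x0; set y := row_comb a S x.
have y0 j : 0 < y j.
  have [k kS] := set0Pn _ Sn0; rewrite /y /row_comb (bigD1 k) //=.
  by apply: ltr_pwDl; rewrite ?mulr_gt0 // sumr_ge0 // => *; rewrite ltW // mulr_gt0.
have s0 : 0 < #|S|%:R :> R by rewrite ltr0n card_gt0.
have := permanent_rows_growth a0 y0 (a0 i) iS.
set V0 := permanent (set_rows S y (set_row a i y)).
set N0 := permanent (set_rows S y (set_row a i (a i))).
have pos w : (forall j, 0 < w j) -> 0 < permanent (set_rows S y (set_row a i w)).
  by move=> w0; apply: permanent_gt0 => h j; rewrite /set_rows /set_row; do 2?case: ifP.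
have V00 : 0 < V0 by exact: pos.
have N00 : 0 < N0 by exact: pos.
(* The minimizer of (1 + t N0 / V0) ^ m / t, with m = #|S| + 1. *)
pose t := V0 / (#|S|%:R * N0).
have t0 : 0 < t by rewrite divr_gt0 // mulr_gt0.
move=> /(_ t t0).
have -> : 1 + t * (N0 / V0) = #|S|.+1%:R / #|S|%:R.
  by rewrite /t -natr1; field; rewrite ?gt_eqF.
pose x' k := if k == i then t else x k.
have x'0 k : 0 < x' k by rewrite /x'; case: ifP.
have := H x' x'0; rewrite cardsU1 iS big_setU1 //= {1 2}/x' eqxx.
have -> : \prod_(k in S) x' k = \prod_(k in S) x k.
  by apply: eq_bigr => k kS; rewrite /x'; case: eqP kS iS => // -> ->.
rewrite (_ : permanent (set_rows (i |: S) _ a) =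
   permanent (set_rows S (fun j => y j + t * a i j) (set_row a i (fun j => y j + t * a i j)))).
  rewrite (_ : permanent (set_rows S y a) = N0); last first.
    by apply: eq_permanent => h j; rewrite /set_rows /set_row; case: eqP => [->|].
  rewrite add1n => h1 h2; have := le_trans h1 h2; rewrite expr_div_n.
  set P := \prod_(k in S) x k; set m := #|S|.
  rewrite (exprS m%:R m) /t -/m.
  have A0 : 0 < m.+1%:R ^+ m.+1 :> R by rewrite exprn_gt0 // ltr0n.
  have B0 : 0 < m%:R ^+ m :> R by rewrite exprn_gt0.
  have s0' : 0 < m%:R :> R := s0.
  move: A0 B0 s0'; set A := m.+1%:R ^+ m.+1; set B := m%:R ^+ m.
  set c := m%:R => A0 B0 c0.
  have c0' : c != 0 by rewrite gt_eqF.
  have -> : K * A * (V0 / (c * N0) * P) = (K * B * P) * (V0 * (A / (c * B)) / N0).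
    by field; rewrite c0' !gt_eqF.
  rewrite mulrA ler_pdivrMr // [leRHS]mulrC ler_pM2r //.
  by rewrite !(divr_gt0, mulr_gt0).
have cE j : row_comb a (i |: S) x' j = y j + t * a i j.
  rewrite /row_comb big_setU1 //= /x' eqxx addrC; congr (_ + _).
  by apply: eq_bigr => k kS; case: eqP kS iS => // -> ->.
apply: eq_permanent => h j; rewrite /set_rows /set_row !inE.
case: eqP => [->|_] /=; first by rewrite (negPf iS) cE.
by case: ifP => // _; exact: cE.
Qed.

Lemma capacity_gt0 a S (K : R) : (forall k j, 0 < a k j) -> S != set0 ->
  (forall x, (forall k, 0 < x k) ->
    K * #|S|%:R ^+ #|S| * \prod_(k in S) x k <= permanent (set_rows S (row_comb a S x) a)) ->
  K <= permanent a.
Proof.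
move=> a0; have [n] := ubnP #|S|; elim: n S => // n IH S Sn S0 H.
have [i iS] := set0Pn _ S0.
have SE : S = i |: (S :\ i) by rewrite setD1K.
have iS' : i \notin S :\ i by rewrite !inE eqxx.
have [S1|S1] := eqVneq (S :\ i) set0; last first.
  apply: (IH (S :\ i)) => //; first by move: Sn; rewrite {1}SE cardsU1 iS'.
  by apply: capacity_step iS' S1 _ => //; rewrite -SE.
have := H (fun=> 1) (fun=> ltr01); rewrite SE S1 setU0 cards1 big_set1 expr1 !mulr1.
rewrite (_ : permanent (set_rows _ _ _) = permanent a) //; apply: eq_permanent => h j.
by rewrite /set_rows inE /row_comb; case: eqP => // ->; rewrite big_set1 mul1r.
Qed.

(** A lower bound for the permanent with the rows of S replaced by a common
    nonnegative combination descends to the permanent itself.  The factor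
    m ^ m, where m = #|S|, absorbs the constants (m - 1) ^ (m - 1) / m ^ m of
    the successive steps. *)
Lemma capacity a S (K : R) : (forall k j, 0 <= a k j) ->
  (forall x, (forall k, 0 < x k) ->
    K * #|S|%:R ^+ #|S| * \prod_(k in S) x k <= permanent (set_rows S (row_comb a S x) a)) ->
  K <= permanent a.
Proof.
move=> a0 H.
have [S0|S0] := eqVneq S set0.
  have := H (fun=> 1) (fun=> ltr01); rewrite S0 cards0 big_set0 expr0 !mulr1.
  rewrite (_ : permanent (set_rows _ _ _) = permanent a) //.
  by apply: eq_permanent => h j; rewrite /set_rows inE.
pose q : {poly R} := permanent (fun k j => (a k j)%:P + 'X) - K%:P.
have qE e : q.[e] = permanent (fun k j => a k j + e) - K.
  rewrite /q !hornerE; congr (_ - _); rewrite -[LHS]/(horner_eval e _) rmorph_permanent.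
  by apply: eq_permanent => h j; rewrite /= /horner_eval !hornerE.
have : 0 <= q.[0].
  apply: (horner0_ge0 ltr01) => e /andP[e0 _]; rewrite qE subr_ge0.
  apply: (@capacity_gt0 _ S) => [k j||x x0] //; first exact: ltr_wpDl.
  apply: le_trans (H x x0) _; apply: ler_permanent => k j; rewrite /set_rows /row_comb.
  case: ifP => _; last by rewrite a0 lerDl ltW.
  rewrite sumr_ge0 => [|h _]; last by rewrite mulr_ge0 // ltW.
  by apply: ler_sum => h _; rewrite ler_pM2l // lerDl ltW.
rewrite qE subr_ge0; congr (_ <= _); apply: eq_permanent => h j; exact: addr0.
Qed.

End Capacity.

(** Counts only the permutations that map I onto J: they form a coset of the
    product of the symmetric groups of I and of its complement. *)
Lemma permanent_two_rows_ge (R : numDomainType) (T : finType) (I J : {set T})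
    (t : {perm T}) (y y' : T -> R) :
  (forall i, (t i \in J) = (i \in I)) ->
  (forall j, 0 <= y j) -> (forall j, 0 <= y' j) ->
  ((#|I|)`! * (#|~: I|)`!)%:R * (\prod_(j in J) y j * \prod_(j in ~: J) y' j)
    <= permanent (set_rows I y (fun=> y')).
Proof.
move=> tIJ y0 y'0; pose G := (Sym I * Sym (~: I))%g.
have cG : #|G| = ((#|I|)`! * (#|~: I|)`!)%N.
  rewrite /G -!card_Sym TI_cardMg //; apply/eqP; rewrite eqEsubset sub1G andbT.
  apply/subsetP => s; rewrite !inE => /andP[s1 s2]; apply/eqP/permP => i.
  rewrite perm1; apply: contraTeq isT => si.
  have := subsetP s1 i; have := subsetP s2 i; rewrite !inE si => H1 H2.
  by have := H1 isT; rewrite H2.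
have sG s : s \in G -> forall i, (s i \in I) = (i \in I).
  case/mulsgP => u v; rewrite !inE => uI vI -> i; rewrite permM.
  by move: (perm_closed (u i) vI) (perm_closed i uI); rewrite !inE => /negb_inj -> ->.
rewrite -cG mulr_natl -sumr_const.
rewrite /permanent [leRHS](reindex_inj (mulIg t)) /= [leRHS](bigID (mem G)) /= ler_wpDr //.
  by apply: sumr_ge0 => s _; apply: prodr_ge0 => i _; rewrite /set_rows; case: ifP.
apply: ler_sum => s /sG sI.
rewrite le_eqVlt; apply/orP; left; apply/eqP.
have E i : ((s * t)%g i \in J) = (i \in I) by rewrite permM tIJ sI.
have -> : \prod_(j in J) y j = \prod_(i in I) y ((s * t)%g i).
  by rewrite (reindex_inj (@perm_inj _ (s * t)%g)); apply: eq_bigl.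
have -> : \prod_(j in ~: J) y' j = \prod_(i | i \notin I) y' ((s * t)%g i).
  by rewrite (reindex_inj (@perm_inj _ (s * t)%g)); apply: eq_bigl => i; rewrite inE E.
rewrite [RHS](bigID (mem I)) /=; congr (_ * _); apply: eq_bigr => i iI.
  by rewrite /set_rows iI.
by rewrite /set_rows (negPf iI).
Qed.

(** Applying the capacity bound to the rows of I and then to the others gives the
    constant of van der Waerden's bound for two blocks, which is larger than the
    one for a single block by a factor of at least 2 (fact_exp_split_ge). *)
Lemma capacity_blocks (R : rcfType) (T : finType) (a : T -> T -> R)
    (I J : {set T}) (t : {perm T}) (K : R) :
  (forall i j, 0 <= a i j) -> (forall i, (t i \in J) = (i \in I)) ->
  (forall x, (forall i, 0 < x i) ->
    K * (#|I| ^ #|I| * #|~: I| ^ #|~: I|)%:R * \prod_i x i <=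
    ((#|I|)`! * (#|~: I|)`!)%:R *
      (\prod_(j in J) row_comb a I x j * \prod_(j in ~: J) row_comb a (~: I) x j)) ->
  K <= permanent a.
Proof.
move=> a0 tIJ H; apply: (@capacity R T a I) => // x x0.
have cge0 S z j : (forall i, 0 < z i) -> 0 <= row_comb a S z j.
  by move=> z0; apply: sumr_ge0 => k _; rewrite mulr_ge0 // ltW.
apply: (@capacity R T _ (~: I)) => [k j|x' x'0].
  by rewrite /set_rows; case: ifP => // _; exact: cge0.
pose z i := if i \in I then x i else x' i.
have z0 i : 0 < z i by rewrite /z; case: ifP.
have c1 j : row_comb a I z j = row_comb a I x j.
  by apply: eq_bigr => i iI; rewrite /z iI.
have c2 j : row_comb (set_rows I (row_comb a I x) a) (~: I) x' j = row_comb a (~: I) z j.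
  by apply: eq_bigr => i; rewrite inE /set_rows /z => /negPf ->.
have := H z z0; rewrite (bigID (mem I)) /=.
have -> : \prod_(i in I) z i = \prod_(i in I) x i.
  by apply: eq_bigr => i iI; rewrite /z iI.
have -> : \prod_(i | i \notin I) z i = \prod_(i in ~: I) x' i.
  by apply: eq_big => i; rewrite ?inE // /z => /negPf ->.
move=> H1; rewrite [leLHS](_ : _ = K * (#|I| ^ #|I| * #|~: I| ^ #|~: I|)%:R *
   (\prod_(i in I) x i * \prod_(i in ~: I) x' i)); last first.
  by rewrite natrM !natrX; ring.
apply: le_trans H1 _.
have := @permanent_two_rows_ge R T I J t (row_comb a I z) (row_comb a (~: I) z) tIJ
   (fun j => cge0 _ _ _ z0) (fun j => cge0 _ _ _ z0).
move=> H2; apply: le_trans H2 _; rewrite le_eqVlt; apply/orP; left; apply/eqP.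
apply: eq_permanent => i j; rewrite /set_rows inE; case: ifP => iI /=; first by rewrite c1.
by rewrite -c2.
Qed.

Section WeightedAMGM.
Variables (R : realType) (T : finType).

(** Weighted AM-GM inequality in each column with the weights Q: if b dominates Q
    up to the factors kappa (1 + X i - Z j), then, Q being doubly stochastic, the
    sum with weights Q of the logarithms of these factors is at most
    #|T| ln kappa + sum X - sum Z. *)
Lemma doubly_stochastic_amgm (b Q : T -> T -> R) (X Z : T -> R) (kappa : R) :
  (forall i j, 0 <= b i j) -> (forall i j, 0 <= Q i j) ->
  (forall i, \sum_j Q i j = 1) -> (forall j, \sum_i Q i j = 1) ->
  0 < kappa ->
  (forall i j, Q i j <= kappa * (1 + (X i - Z j)) * b i j) ->
  forall x, (forall i, 0 < x i) ->
  (1 - (\sum_i X i - \sum_j Z j)) * \prod_i x i <=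
    kappa ^+ #|T| * \prod_j row_comb b setT x j.
Proof.
move=> b0 Q0 Qr Qc k0 Qb x x0.
set y := row_comb b setT x.
have y_ge0 j : 0 <= y j by apply: sumr_ge0 => i _; rewrite mulr_ge0 // ltW.
have key j : 0 < y j /\ \sum_i Q i j * (ln (x i) - X i) <= ln kappa + ln (y j) - Z j.
  have pos i : 0 < Q i j -> 0 < b i j /\ 0 < 1 + (X i - Z j).
    move=> Qij; have := lt_le_trans Qij (Qb i j).
    have [->|bn0] := eqVneq (b i j) 0; first by rewrite mulr0 ltxx.
    have bp : 0 < b i j by rewrite lt_def bn0 b0.
    by rewrite pmulr_lgt0 // pmulr_rgt0.
  have yj : 0 < y j.
    rewrite lt_def y_ge0 andbT; apply: contraTneq isT => yj0.
    have : \sum_i Q i j = 0.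
      apply: big1 => i _; apply/eqP; rewrite eq_le Q0 andbT leNgt.
      apply/negP => /pos[bp _].
      have : x i * b i j <= y j.
        rewrite /y /row_comb (bigD1 i) //= lerDl sumr_ge0 // => k _.
        by rewrite mulr_ge0 // ltW.
      by rewrite yj0 leNgt mulr_gt0.
    by rewrite Qc => /eqP; rewrite oner_eq0.
  split=> //; rewrite -[leRHS]mul1r -(Qc j) mulr_suml -subr_ge0 -sumrB.
  have S0 : \sum_i (Q i j - x i * b i j / y j) = 0.
    rewrite sumrB Qc -mulr_suml; have -> : \sum_i x i * b i j = y j.
      by rewrite /y /row_comb; apply: eq_bigl => i; rewrite inE.
    by rewrite divff ?subrr // gt_eqF.
  rewrite -[leLHS]S0; apply: ler_sum => i _.
  have [->|Qn0] := eqVneq (Q i j) 0.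
    by rewrite !mul0r subrr sub0r oppr_le0 divr_ge0 // mulr_ge0 // ltW.
  have Qp : 0 < Q i j by rewrite lt_def Qn0 Q0.
  have [bp lp] := pos i Qp.
  set l := X i - Z j in lp *.
  (* Jensen's inequality in the form ln z <= z - 1; the weighted sum of z - 1
     over the column is at most 0. *)
  pose z := x i / (kappa * (1 + l) * y j).
  have z0 : 0 < z by rewrite divr_gt0 // !mulr_gt0.
  have lz : ln z = ln (x i) - (ln kappa + ln (1 + l) + ln (y j)).
    rewrite /z ln_div ?posrE ?mulr_gt0 // !lnM ?posrE ?mulr_gt0 //.
  have l1 : ln z <= z - 1.
    by have := @le_ln1Dx R (z - 1); rewrite addrCA subrr addr0; apply; lra.
  have l2 : ln (1 + l) <= l by apply: le_ln1Dx; lra.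
  have Qz : Q i j * z <= x i * b i j / y j.
    rewrite /z mulrA ler_pdivrMr ?mulr_gt0 //.
    rewrite [leRHS](_ : _ = x i * (kappa * (1 + l) * b i j)); last first.
      by field; rewrite gt_eqF.
    by rewrite mulrC ler_pM2l // Qb.
  apply: (@le_trans _ _ (Q i j - Q i j * z)); first by rewrite lerD2l lerN2.
  rewrite -{1}[Q i j]mulr1 -!mulrBr ler_pM2l //.
  by move: l1 l2; rewrite lz /l; lra.
have : \sum_j \sum_i Q i j * (ln (x i) - X i) <=
    \sum_j (ln kappa + ln (y j) - Z j).
  by apply: ler_sum => j _; have [] := key j.
rewrite exchange_big /= (eq_bigr (fun i => ln (x i) - X i)); last first.
  by move=> i _; rewrite -mulr_suml Qr mul1r.
rewrite !(big_split, sumrN) /= sumr_const => H.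
have yp j : 0 < y j by have [] := key j.
have -> : \prod_i x i = expR (\sum_i ln (x i)).
  by rewrite expR_sum; apply: eq_bigr => i _; rewrite lnK // posrE.
have -> : \prod_j y j = expR (\sum_j ln (y j)).
  by rewrite expR_sum; apply: eq_bigr => i _; rewrite lnK // posrE.
have -> : kappa ^+ #|T| = expR (ln kappa *+ #|T|).
  by rewrite -mulr_natl expRM_natl lnK // posrE.
rewrite -expRD.
apply: (@le_trans _ _ (expR (- (\sum_i X i - \sum_j Z j)) * expR (\sum_i ln (x i)))).
  by rewrite ler_pM2r ?expR_gt0 // expR_ge1Dx.
rewrite -expRD ler_expR; move: H.
by lra.
Qed.

End WeightedAMGM.

(** * Products and gaps of real numbers *)

Section AMGM.
Variables (R : realFieldType) (T : finType).
Implicit Types r : T -> R.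

Lemma prod_le1 r : (forall i, 0 <= r i) -> \sum_i r i = #|T|%:R -> \prod_i r i <= 1.
Proof.
move=> r0 rs; have [T0|T0] := eqVneq #|T| 0%N.
  rewrite big_pred0 // => i; have := max_card (pred1 i).
  by rewrite T0 card1.
have Tn : #|T|%:R != 0 :> R by rewrite pnatr_eq0.
have [+ _] := @leif_AGM R T predT r (fun i _ => r0 i).
by rewrite rs divff // expr1n.
Qed.

(** Replacing two factors by their mean keeps the sum, so the new product is still
    at most 1. *)
Lemma prod_pair_le r i k : (forall i, 0 < r i) -> \sum_i r i = #|T|%:R ->
  (r i + r k) ^+ 2 * \prod_j r j <= 4 * (r i * r k).
Proof.
move=> r0 rs; have [<-|ik] := eqVneq i k.
  rewrite [leRHS](_ : _ = (r i + r i) ^+ 2); last by ring.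
  by rewrite ler_piMr ?sqr_ge0 // prod_le1 // => j; exact: ltW.
pose m := (r i + r k) / 2.
pose r' j := if (j == i) || (j == k) then m else r j.
have ki : k != i by rewrite eq_sym.
have : \prod_j r' j <= 1.
  apply: prod_le1 => [j|].
    rewrite /r' /m; case: ifP => _; last exact: ltW.
    by rewrite ltW // divr_gt0 // addr_gt0.
  rewrite -rs (bigD1 i) //= (bigD1 k) //= [RHS](bigD1 i) //= [in RHS](bigD1 k) //=.
  rewrite /r' !eqxx orbT /= !addrA; congr (_ + _); first by rewrite /m; lra.
  by apply: eq_bigr => j /andP[/negPf -> /negPf ->].
rewrite (bigD1 i) //= (bigD1 k) //= [\prod_j r j](bigD1 i) //= [\prod_(j | j != i) r j](bigD1 k) //=.
rewrite /r' !eqxx orbT /=.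
rewrite (eq_bigr r); last by move=> j /andP[/negPf -> /negPf ->].
set P := \prod_(j | _) _; rewrite mulrA => H.
rewrite [leLHS](_ : _ = 4 * (r i * r k) * (m * m * P)); last by rewrite /m; field.
by rewrite ler_piMr // !mulr_ge0 // ltW.
Qed.

(** A product close to the AM-GM bound forces any two factors to be close, by
    prod_pair_le, and each factor is compared with the mean of all of them. *)
Lemma prod_near1 r (d : R) : 0 <= d -> (forall i, 0 < r i) ->
  \sum_i r i = #|T|%:R -> 1 - d ^+ 2 <= \prod_i r i ->
  forall i, `|r i - 1| <= d * (r i + 1).
Proof.
move=> d0 r0 rs pr i.
have pair k : `|r i - r k| <= d * (r i + r k).
  have rr : 0 <= r i + r k by rewrite addr_ge0 // ltW.
  rewrite -(@ler_pXn2r _ 2) ?nnegrE ?mulr_ge0 // real_normK ?num_real //.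
  have := prod_pair_le i k r0 rs.
  have : (r i + r k) ^+ 2 * (1 - d ^+ 2) <= (r i + r k) ^+ 2 * \prod_j r j.
    by rewrite ler_wpM2l // sqr_ge0.
  by rewrite exprMn; nra.
have Tp : 0 < #|T|%:R :> R by rewrite ltr0n; apply/card_gt0P; exists i.
rewrite -(ler_pM2l Tp) -{1}(gtr0_norm Tp) -normrM mulrBr mulr1 -[X in `|_ - X|]rs.
rewrite (_ : _ - _ = \sum_k (r i - r k)); last by rewrite sumrB sumr_const mulr_natl.
apply: le_trans (ler_norm_sum _ _ _) _.
apply: le_trans (ler_sum _ (fun k _ => pair k)) _.
by rewrite -mulr_sumr big_split /= sumr_const rs -mulr_natl; lra.
Qed.

End AMGM.

Section Gap.
Variable R : realFieldType.

(** The largest of the N + 1 consecutive gaps is at least their mean. *)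
Lemma sorted_gap (s : seq R) N : sorted <=%R s -> size s = N.+2 ->
  exists2 i, (i < N.+1)%N & s`_N.+1 - s`_0 <= N.+1%:R * (s`_i.+1 - s`_i).
Proof.
move=> ss sz.
pose d (i : 'I_N.+1) := s`_i.+1 - s`_i.
pose m := [arg max_(i > ord0) d i]%O.
exists m => //.
rewrite -[leLHS](telescope_sumr (fun i => s`_i) (leq0n N.+1)) big_mkord.
rewrite mulr_natl -[X in _ *+ X]card_ord -sumr_const; apply: ler_sum => i _.
by rewrite /m; case: arg_maxP => //= j _; apply.
Qed.

Lemma exists_gap (U : finType) (v : U -> R) u0 w0 : v u0 != v w0 ->
  exists t g, [/\ 0 < g, forall u, (t <= v u) || (v u <= t - g),
    (exists u, t <= v u), (exists u, v u <= t - g) &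
    forall u w, v u - v w <= #|U|.-1%:R * g].
Proof.
move=> uw; pose s := sort <=%R (map v (enum U)).
have sz : size s = #|U| by rewrite size_sort size_map cardE.
have ss : sorted <=%R s by apply: sort_sorted; exact: le_total.
have ms u : v u \in s by rewrite mem_sort map_f // mem_enum.
have uw' : u0 != w0 by apply: contraNneq uw => ->.
have [N UN] : exists N, #|U| = N.+2.
  have := max_card (pred2 u0 w0); rewrite card2 uw'.
  by case: #|U| => [|[|N]] // _; exists N.
rewrite UN in sz *; have [i iN gap] := sorted_gap ss sz.
have nthP k l : (k <= l)%N -> (l < N.+2)%N -> s`_k <= s`_l.
  move=> kl lN; apply: (sorted_leq_nth le_trans le_refl) => //; rewrite inE sz //.
  exact: leq_ltn_trans lN.
have idx u : exists2 k, (k < N.+2)%N & v u = s`_k.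
  by exists (index (v u) s); [rewrite -sz index_mem | rewrite nth_index].
have rng u w : v u - v w <= N.+1%:R * (s`_i.+1 - s`_i).
  apply: le_trans gap; have [k kN ->] := idx u; have [l lN ->] := idx w.
  by apply: lerB; apply: nthP.
exists s`_i.+1, (s`_i.+1 - s`_i); split=> //.
- rewrite ltNge; apply/negP => g0; case/eqP: uw; apply/eqP; rewrite eq_le.
  have H u w : v u <= v w.
    rewrite -subr_le0; apply: le_trans (rng u w) _.
    by rewrite mulr_ge0_le0.
  by rewrite !H.
- move=> u; have [k kN ->] := idx u; rewrite subKr.
  by case: (leqP i.+1 k) => ik; apply/orP; [left|right]; apply: nthP => //; exact: ltnW.
- have : s`_i.+1 \in s by rewrite mem_nth // sz.
  by rewrite mem_sort => /mapP[u _ ->]; exists u.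
- have : s`_i \in s by rewrite mem_nth // sz ltnS ltnW.
  by rewrite mem_sort => /mapP[u _ E]; exists u; rewrite subKr E.
Qed.
End Gap.

(** * Energy of the potentials *)

Section Energy.
Variables (R : realFieldType) (T : finType) (a : T -> T -> R) (rp cp : R).
Local Notation n := (#|T|%:R : R).
Local Notation r := (fun i => \sum_j a i j).
Local Notation c := (fun j => \sum_i a i j).
Local Notation p := (permanent a).

(** At a maximizer, with rp and cp the products of the row and column sums, the
    first-order conditions say that minor a i j is at least
    permanent a + row_potential i - col_potential j, with equality where
    a i j > 0 (see maximizer_doubly_stochastic).  The potentials measure how far
    the row and column sums are from 1. *)
Definition row_potential i := rp / r i - rp.
Definition col_potential j := cp - cp / c j.
Local Notation X := row_potential.
Local Notation Z := col_potential.

Definition energy := \sum_i \sum_j a i j * (X i - Z j) ^+ 2.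

Hypothesis r_gt0 : forall i, 0 < r i.
Hypothesis c_gt0 : forall j, 0 < c j.
Hypothesis rp_gt0 : 0 < rp.
Hypothesis cp_gt0 : 0 < cp.
Hypothesis a_sum : \sum_i r i = n.
Hypothesis minorE : forall i j, a i j * minor a i j = a i j * (p + X i - Z j).

Let c_sum : \sum_j c j = n.
Proof. by rewrite exchange_big. Qed.

Let rX i : r i * X i = rp * (1 - r i).
Proof. by rewrite /X; field; rewrite gt_eqF. Qed.

Let cZ j : c j * Z j = cp * (c j - 1).
Proof. by rewrite /Z; field; rewrite gt_eqF. Qed.

Lemma sum_row_potential : \sum_i r i * X i = 0.
Proof.
rewrite (eq_bigr _ (fun i _ => rX i)) -mulr_sumr sumrB a_sum sumr_const.
by rewrite subrr mulr0.
Qed.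

Lemma sum_col_potential : \sum_j c j * Z j = 0.
Proof.
rewrite (eq_bigr _ (fun i _ => cZ i)) -mulr_sumr sumrB c_sum sumr_const.
by rewrite subrr mulr0.
Qed.

(** Expand the permanent along row i and use the values of the minors: up to the
    factor 1 - p / rp, which is almost 1, the potentials are harmonic on the
    weighted bipartite graph of a. *)
Lemma row_eigen i : \sum_j a i j * Z j = (1 - p / rp) * (r i * X i).
Proof.
have : p = \sum_j a i j * (p + X i - Z j).
  by rewrite [LHS](permanent_minor a i); apply: eq_bigr => j _; rewrite minorE.
rewrite (eq_bigr (fun j => a i j * (p + X i) - a i j * Z j)) => [|j _]; last by ring.
rewrite sumrB -mulr_suml => E.
have -> : \sum_j a i j * Z j = r i * (p + X i) - p by rewrite [X in _ - X]E; ring.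
have -> : r i * (p + X i) - p = r i * X i - p * (1 - r i) by ring.
have -> : 1 - r i = r i * X i / rp by rewrite rX mulrC mulKf // gt_eqF.
by ring.
Qed.

Lemma col_eigen j : \sum_i a i j * X i = (1 - p / cp) * (c j * Z j).
Proof.
have : p = \sum_i a i j * (p + X i - Z j).
  by rewrite [LHS](permanent_minor_col a j); apply: eq_bigr => i _; rewrite minorE.
rewrite (eq_bigr (fun i => a i j * (p - Z j) + a i j * X i)) => [|i _]; last by ring.
rewrite big_split /= -mulr_suml => E.
have -> : \sum_i a i j * X i = p - c j * (p - Z j) by rewrite [X in X - _]E; ring.
have -> : p - c j * (p - Z j) = c j * Z j - p * (c j - 1) by ring.
have -> : c j - 1 = c j * Z j / cp by rewrite cZ mulrC mulKf // gt_eqF.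
by ring.
Qed.

(** The near-harmonicity makes the Dirichlet energy of the potentials smaller than
    their variance by a factor of the order of the permanent. *)
Lemma energyE : energy =
  p / rp * (\sum_i r i * X i ^+ 2) + p / cp * (\sum_j c j * Z j ^+ 2).
Proof.
have cross1 : \sum_i \sum_j a i j * (X i * Z j) = (1 - p / rp) * \sum_i r i * X i ^+ 2.
  rewrite mulr_sumr; apply: eq_bigr => i _.
  rewrite (eq_bigr (fun j => X i * (a i j * Z j))) => [|j _]; last by ring.
  by rewrite -mulr_sumr row_eigen; ring.
have cross2 : \sum_i \sum_j a i j * (X i * Z j) = (1 - p / cp) * \sum_j c j * Z j ^+ 2.
  rewrite exchange_big mulr_sumr; apply: eq_bigr => j _ /=.
  rewrite (eq_bigr (fun i => Z j * (a i j * X i))) => [|i _]; last by ring.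
  by rewrite -mulr_sumr col_eigen; ring.
rewrite /energy.
rewrite (_ : \sum_i _ = \sum_i r i * X i ^+ 2 + \sum_j c j * Z j ^+ 2
    - 2 * \sum_i \sum_j a i j * (X i * Z j)); last first.
  have -> : \sum_j c j * Z j ^+ 2 = \sum_i \sum_j a i j * Z j ^+ 2.
    by rewrite exchange_big; apply: eq_bigr => j _; rewrite mulr_suml.
  rewrite mulr_sumr -big_split -sumrB /=; apply: eq_bigr => i _.
  rewrite mulr_suml mulr_sumr -big_split -sumrB /=; apply: eq_bigr => j _.
  by ring.
by rewrite mulr_natl mulr2n {1}cross1 cross2; ring.
Qed.

(** Twice the variance is the weighted mean of the squares (Y i - Y k)^2. *)
Lemma weighted_variance_le (w Y : T -> R) (D : R) :
  (forall i, 0 <= w i) -> \sum_i w i = n -> \sum_i w i * Y i = 0 ->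
  (forall i k, Y i - Y k <= D) -> \sum_i w i * Y i ^+ 2 <= n * D ^+ 2 / 2.
Proof.
move=> w0 ws wY YD.
have [T0|/card_gt0P[i0 _]] := posnP #|T|.
  rewrite big_pred0 ?T0 ?mul0r // => i; have := max_card (pred1 i).
  by rewrite T0 card1.
have n0 : 0 < n by rewrite ltr0n; apply/card_gt0P; exists i0.
set S := \sum_i w i * Y i ^+ 2.
have E : \sum_i \sum_k w i * w k * (Y i - Y k) ^+ 2 = 2 * n * S.
  have inner i : \sum_k w i * w k * (Y i - Y k) ^+ 2 = w i * Y i ^+ 2 * n + w i * S.
    rewrite (_ : \sum_k _ = w i * Y i ^+ 2 * (\sum_k w k)
       - 2 * w i * Y i * (\sum_k w k * Y k) + w i * S).
      by rewrite ws wY; ring.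
    rewrite /S !mulr_sumr -sumrB -big_split /=; apply: eq_bigr => k _; ring.
  rewrite (eq_bigr _ (fun i _ => inner i)) big_split /= -!mulr_suml ws -/S; ring.
have : 2 * n * S <= \sum_i \sum_k w i * w k * D ^+ 2.
  rewrite -E; apply: ler_sum => i _; apply: ler_sum => k _.
  apply: ler_wpM2l; first by rewrite mulr_ge0.
  by have := YD i k; have := YD k i; nra.
rewrite (_ : \sum_i \sum_k _ = n * n * D ^+ 2); last first.
  rewrite (eq_bigr (fun i => w i * (n * D ^+ 2))) => [|i _].
    by rewrite -mulr_suml ws mulrA.
  by rewrite -ws mulr_suml mulr_sumr; apply: eq_bigr => k _; ring.
rewrite (_ : 2 * n * S = n * (2 * S)); last by ring.
by rewrite -mulrA ler_pM2l // => ?; lra.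
Qed.

Lemma energy_le (D : R) : 0 <= p ->
  (forall i k, X i - X k <= D) -> (forall i k, Z i - Z k <= D) ->
  energy <= (p / rp + p / cp) * (n * D ^+ 2 / 2).
Proof.
move=> p0 XD ZD; rewrite energyE mulrDl; apply: lerD.
  apply: ler_wpM2l; first by rewrite divr_ge0 // ltW.
  by apply: weighted_variance_le sum_row_potential XD => // i; exact: ltW.
apply: ler_wpM2l; first by rewrite divr_ge0 // ltW.
by apply: weighted_variance_le sum_col_potential ZD => // i; exact: ltW.
Qed.

(** Compare the sums of X i - Z j weighted by a i j * minor a i j, whose row and
    column sums are all p, and by a i j, for which the sum is 0. *)
Lemma energy_sum_potential : p * (\sum_i X i - \sum_j Z j) = energy.
Proof.
have E1 : p * \sum_i X i = \sum_i \sum_j a i j * (p + X i - Z j) * X i.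
  rewrite mulr_sumr; apply: eq_bigr => i _; rewrite -mulr_suml; congr (_ * _).
  by rewrite [LHS](permanent_minor a i); apply: eq_bigr => j _; rewrite minorE.
have E2 : p * \sum_j Z j = \sum_i \sum_j a i j * (p + X i - Z j) * Z j.
  rewrite exchange_big mulr_sumr; apply: eq_bigr => j _; rewrite -mulr_suml.
  congr (_ * _).
  by rewrite [LHS](permanent_minor_col a j); apply: eq_bigr => i _; rewrite minorE.
have E3 : \sum_i \sum_j a i j * (X i - Z j) = 0.
  have -> : \sum_i \sum_j a i j * (X i - Z j) = \sum_i r i * X i - \sum_j c j * Z j.
    have -> : \sum_j c j * Z j = \sum_i \sum_j a i j * Z j.
      by rewrite exchange_big; apply: eq_bigr => j _; rewrite mulr_suml.
    rewrite -sumrB; apply: eq_bigr => i _.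
    by rewrite mulr_suml -sumrB; apply: eq_bigr => j _; ring.
  by rewrite sum_row_potential sum_col_potential subrr.
transitivity (energy + p * (\sum_i \sum_j a i j * (X i - Z j))); last first.
  by rewrite E3 mulr0 addr0.
rewrite /energy mulrBr E1 E2 -sumrB mulr_sumr -big_split /=.
apply: eq_bigr => i _; rewrite mulr_sumr -sumrB -big_split /=.
by apply: eq_bigr => j _; ring.
Qed.

End Energy.

(** * Matrices with unequal potentials *)

Section SplitFactorial.
Local Open Scope nat_scope.

(** In the binomial expansion of (l + k) ^ (k + l), the term 'C(k + l, k) k^k l^l
    has two neighbours, each at least half as large. *)
Lemma fact_expn_split k l : 0 < k -> 0 < l ->
  2 * (k + l)`! * (k ^ k * l ^ l) <= k`! * l`! * (k + l) ^ (k + l).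
Proof.
case: k l => [|k] [|l] // _ _.
set n := k.+1 + l.+1.
have [lt1 lt2 lt3] : [/\ k < n.+1, k.+1 < n.+1 & k.+2 < n.+1] by rewrite /n; split; lia.
pose t i := 'C(n, i) * (l.+1 ^ (n - i) * k.+1 ^ i).
have tE : n ^ n = \sum_(i < n.+1) t i by rewrite {1}/n addnC expnDn.
have nk : n - k.+1 = l.+1 by rewrite addKn.
have nk' : n - k = l.+2 by rewrite /n; lia.
have nk'' : n - k.+2 = l by rewrite /n; lia.
have t1 : l.+2 * t k = l.+1 * t k.+1.
  have := mul_bin_left n k; rewrite /t nk nk' => E.
  by rewrite mulnA -E (expnS _ l.+1) (expnS _ k); ring.
have t2 : k.+2 * t k.+2 = k.+1 * t k.+1.
  have := mul_bin_left n k.+1; rewrite /t nk nk'' => E.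
  by rewrite mulnA E (expnS _ l) (expnS _ k.+1); ring.
have big : 2 * t k.+1 <= n ^ n.
  have d1 : t k.+1 <= 2 * t k.
    by rewrite -(leq_pmul2l (ltn0Sn l)) -t1 mulnA leq_mul2r; apply/orP; right; lia.
  have d2 : t k.+1 <= 2 * t k.+2.
    by rewrite -(leq_pmul2l (ltn0Sn k)) -t2 mulnA leq_mul2r; apply/orP; right; lia.
  have s3 : t k + t k.+1 + t k.+2 <= n ^ n.
    rewrite tE -(big_mkord predT t) (@big_cat_nat _ _ _ k) //=; last exact: ltnW.
    rewrite (big_ltn lt1) (big_ltn lt2) (big_ltn lt3) -!addnA.
    by rewrite [leqRHS]addnCA leq_add2l [leqRHS]addnCA leq_add2l [leqRHS]addnCA leq_addr.
  lia.
have B : 'C(n, k.+1) * (k.+1`! * l.+1`!) = n`! by rewrite -nk bin_fact // leq_addr.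
have -> : 2 * n`! * (k.+1 ^ k.+1 * l.+1 ^ l.+1) = k.+1`! * l.+1`! * (2 * t k.+1).
  rewrite -B /t nk; move: 'C(n, k.+1) (k.+1`!) (l.+1`!) (k.+1 ^ k.+1) (l.+1 ^ l.+1).
  by move=> *; ring.
by rewrite leq_mul2l big orbT.
Qed.
End SplitFactorial.

(** The constant 1 / 900 is the scale at which all later estimates are made: it
    is a bound for the square root of the permanent of the uniform matrix. *)
Lemma eps16 (R : realFieldType) : 16`!%:R / 16 ^+ 16 <= (1 / 900) ^+ 2 :> R.
Proof.
rewrite !factS fact0 !natrM. 
lra.
Qed.

Lemma fact_exp_split_ge (R : realFieldType) (k l n : nat) : (k + l)%N = n ->
  (0 < k)%N -> (0 < l)%N ->
  2 * (n`!%:R / n%:R ^+ n) <= (k`! * l`!)%:R / (k ^ k * l ^ l)%:R :> R.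
Proof.
move=> <- k0 l0; have := fact_expn_split k0 l0; rewrite -(ler_nat R) !natrM !natrX => H.
have kkll : 0 < (k%:R ^+ k * l%:R ^+ l : R) by rewrite mulr_gt0 ?exprn_gt0 ?ltr0n.
have n0 : 0 < ((k + l)%:R ^+ (k + l) : R) by rewrite exprn_gt0 // ltr0n addn_gt0 k0.
by rewrite mulrA ler_pdivrMr // mulrAC ler_pdivlMr.
Qed.

Lemma fact_exp_gt0 (R : realFieldType) (n : nat) :
  (0 < n)%N -> 0 < n`!%:R / n%:R ^+ n :> R.
Proof. by move=> n0; rewrite divr_gt0 ?exprn_gt0 ?ltr0n ?fact_gt0. Qed.

Lemma bernoulli_le (R : realFieldType) (x : R) m :
  0 <= x <= 1 -> 1 - m%:R * x <= (1 - x) ^+ m.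
Proof.
case/andP=> x0 x1; elim: m => [|m IH]; first by rewrite mul0r subr0 expr0.
have := ler_wpM2r (_ : 0 <= 1 - x) IH; rewrite subr_ge0 -exprSr => /(_ x1).
apply: le_trans; rewrite -natr1; have : 0 <= m%:R * x ^+ 2 by rewrite mulr_ge0 // sqr_ge0.
by rewrite expr2; set y := m%:R; nra.
Qed.

(** As I and J have the same size, a permutation that does not map I onto J maps
    some element outside I into J. *)
Lemma crossing_perm (T : finType) (I J : {set T}) (s : {perm T}) :
  #|I| = #|J| -> (exists i, (s i \in J) != (i \in I)) ->
  exists2 i, i \notin I & s i \in J.
Proof.
move=> cIJ [i0 si0]; apply/exists_inP; apply: contraNT si0.
rewrite negb_exists_in => /forall_inP H.
have sub : s @^-1: J \subset I.
  apply/subsetP => i; rewrite inE => siJ; apply: contraTT siJ; exact: H.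
have /eqP E : s @^-1: J == I.
  by rewrite eqEcard sub cIJ card_preimset //=; exact: perm_inj.
by rewrite -E inE.
Qed.

Section NonUniformPotentials.
Variables (R : realType) (T : finType) (a : T -> T -> R).
Hypothesis T16 : #|T| = 16%N.
Local Notation r := (fun i => \sum_j a i j).
Local Notation c := (fun j => \sum_i a i j).
Local Notation p := (permanent a).
Local Notation rp := (\prod_i r i).
Local Notation cp := (\prod_j c j).
Local Notation X := (row_potential a rp).
Local Notation Z := (col_potential a cp).
Local Notation eps := (16`!%:R / 16 ^+ 16 : R).

Hypothesis a_ge0 : forall i j, 0 <= a i j.
Hypothesis r_gt0 : forall i, 0 < r i.
Hypothesis c_gt0 : forall j, 0 < c j.
Hypothesis a_sum : \sum_i r i = 16.
Hypothesis rp_near1 : 1 - eps <= rp.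
Hypothesis cp_near1 : 1 - eps <= cp.
Hypothesis p_le : p <= eps.
Hypothesis minorE : forall i j, a i j * minor a i j = a i j * (p + X i - Z j).
Hypothesis minor_ge : forall i j, p + X i - Z j <= minor a i j.

Let p_ge0 : 0 <= p. Proof. exact: permanent_ge0. Qed.
Let eps_le : eps <= (1 / 900) ^+ 2. Proof. exact: eps16. Qed.
Let rp_gt0 : 0 < rp. Proof. by move: rp_near1 eps_le; lra. Qed.
Let cp_gt0 : 0 < cp. Proof. by move: cp_near1 eps_le; lra. Qed.
Let a_sumT : \sum_i r i = #|T|%:R. Proof. by rewrite T16. Qed.
Let c_sumT : \sum_j c j = #|T|%:R. Proof. by rewrite exchange_big. Qed.

Let r_near i : `|r i - 1| <= 1 / 900 * (r i + 1).
Proof.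
by apply: prod_near1 => //; move: rp_near1 eps_le; lra.
Qed.

Let c_near j : `|c j - 1| <= 1 / 900 * (c j + 1).
Proof.
by apply: prod_near1 => //; move: cp_near1 eps_le; lra.
Qed.

(** Split rows and columns at a gap t - g, t of the potentials that is at least
    1 / 31 of their range (there are 32 potentials).  The small energy makes a
    almost block diagonal for the sets I and J of high rows and columns, and two
    large blocks carry too large a permanent. *)
Section Cut.
Variables (t g : R).
Hypothesis g_gt0 : 0 < g.
Hypothesis X_gap : forall i, (t <= X i) || (X i <= t - g).
Hypothesis Z_gap : forall j, (t <= Z j) || (Z j <= t - g).
Hypothesis X_range : forall i k, X i - X k <= 31 * g.
Hypothesis Z_range : forall i k, Z i - Z k <= 31 * g.
Let I := [set i | t <= X i].
Let J := [set j | t <= Z j].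
Hypothesis above : (0 < #|I| + #|J|)%N.
Hypothesis below : (#|I| + #|J| < 32)%N.

Let leak := \sum_i \sum_j (if (i \in I) == (j \in J) then 0 else a i j).

Let Xin i : i \in I -> t <= X i. Proof. by rewrite inE. Qed.
Let Xout i : i \notin I -> X i <= t - g.
Proof. by rewrite inE; case/orP: (X_gap i) => // ->. Qed.
Let Zin j : j \in J -> t <= Z j. Proof. by rewrite inE. Qed.
Let Zout j : j \notin J -> Z j <= t - g.
Proof. by rewrite inE; case/orP: (Z_gap j) => // ->. Qed.

(** Numerically 2 (16 (31 g)^2 / 2) / (900 * 899) < g^2 / 50. *)
Let energy_small : energy a rp cp <= 1 / 50 * g ^+ 2.
Proof.
have small q : 1 - eps <= q -> p / q <= 1 / (900 * 899).
  move=> q1; have q0 : 0 < q by move: q1 eps_le; lra.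
  by rewrite ler_pdivrMr //; move: q1 eps_le p_le; lra.
have H := energy_le r_gt0 c_gt0 rp_gt0 cp_gt0 a_sumT minorE p_ge0 X_range Z_range.
apply: le_trans H _; rewrite T16 exprMn.
have := small _ rp_near1; have := small _ cp_near1.
have : 0 <= g ^+ 2 by rewrite sqr_ge0.
move: (p / rp) (p / cp) (g ^+ 2) => u v w w0 u1 v1.
have : (u + v) * w <= 2 / (900 * 899) * w by apply: ler_wpM2r => //; lra.
by lra.
Qed.

(** An entry outside the blocks joins potentials that differ by at least g. *)
Let leak_le : leak <= 1 / 50.
Proof.
have g2 : 0 < g ^+ 2 by rewrite exprn_gt0.
rewrite -(ler_pM2r g2); apply: le_trans energy_small.
rewrite /leak mulr_suml; apply: ler_sum => i _; rewrite mulr_suml; apply: ler_sum => j _.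
case: ifP => [_|/negP/negP ij]; first by rewrite mul0r mulr_ge0 ?sqr_ge0.
apply: ler_wpM2l => //.
have [iI|iI] := boolP (i \in I); move: ij; rewrite ?iI ?(negPf iI) ?eqbF_neg ?eqb_id => jJ.
  by have := Xin iI; have := Zout jJ; move: g_gt0; nra.
by have := Xout iI; have := Zin (negbNE jJ); move: g_gt0; nra.
Qed.

Let near_card (S : {set T}) (w : T -> R) : \sum_i w i = 16 ->
  (forall i, `|w i - 1| <= 1 / 900 * (w i + 1)) ->
  `|\sum_(i in S) w i - #|S|%:R| <= 32 / 900.
Proof.
move=> ws w1; rewrite -sumr_const -sumrB.
apply: le_trans (ler_norm_sum _ _ _) _.
apply: (@le_trans _ _ (\sum_i 1 / 900 * (w i + 1))); last first.
  by rewrite -mulr_sumr big_split /= ws sumr_const T16; lra.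
rewrite [leRHS](bigID (mem S)) /= ler_wpDr //.
  by apply: sumr_ge0 => i _; apply: le_trans (w1 i).
by apply: ler_sum.
Qed.

(** The row sums over I and the column sums over J differ by the leak at most and
    are within 32 / 900 of the two cardinals, so these differ by less than 1. *)
Let card_IJ : #|I| = #|J|.
Proof.
have dI := near_card I a_sum r_near.
have dJ := near_card J (etrans c_sumT (congr1 _ T16)) c_near.
have : `|\sum_(i in I) r i - \sum_(j in J) c j| <= leak.
  have -> : \sum_(i in I) r i = \sum_i \sum_j (if i \in I then a i j else 0).
    rewrite [LHS]big_mkcond; apply: eq_bigr => i _; case: ifP => // _.
    by rewrite big1.
  have -> : \sum_(j in J) c j = \sum_i \sum_j (if j \in J then a i j else 0).
    rewrite [RHS]exchange_big [LHS]big_mkcond; apply: eq_bigr => j _; case: ifP => // _.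
    by rewrite big1.
  rewrite -sumrB; apply: le_trans (ler_norm_sum _ _ _) _; apply: ler_sum => i _.
  rewrite -sumrB; apply: le_trans (ler_norm_sum _ _ _) _; apply: ler_sum => j _.
  by case: (i \in I); case: (j \in J); rewrite /= ?subrr ?subr0 ?sub0r ?normrN ?normr0 // ger0_norm.
move: dI dJ leak_le; rewrite !ler_norml.
set x := \sum_(i in I) _; set y := \sum_(j in J) _ => dI dJ l1 xy.
have h1 : #|I|%:R < #|J|%:R + 1 :> R by lra.
have h2 : #|J|%:R < #|I|%:R + 1 :> R by lra.
by apply/eqP; move: h1 h2; rewrite !natr1 !ltr_nat !ltnS eqn_leq => -> ->.
Qed.

Let I_gt0 : (0 < #|I|)%N. Proof. by move: above; rewrite -card_IJ addnn double_gt0. Qed.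
Let I_lt16 : (#|I| < 16)%N.
Proof. by move: below; rewrite -card_IJ addnn -[32%N]/(16.*2)%N ltn_double. Qed.

(** If g > p, an entry in a low row and a high column would have a negative minor,
    so that block vanishes.  Then the minor at a high row and a low column is 0,
    although the first-order condition makes it at least p + g. *)
Let gap_le : g <= p.
Proof.
rewrite leNgt; apply/negP => pg.
have zero i j : i \notin I -> j \in J -> a i j = 0.
  move=> iI jJ; apply/eqP; apply: contraTT isT => aij.
  have aij0 : 0 < a i j by rewrite lt_def aij a_ge0.
  have : 0 <= p + X i - Z j by rewrite -(pmulr_rge0 _ aij0) -minorE mulr_ge0 // minor_ge0.
  by have := Xout iI; have := Zin jJ; move: pg; lra.
have /card_gt0P[i0 i0I] := I_gt0.
have [j0 j0J] : exists j0, j0 \notin J.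
  have : (0 < #|~: J|)%N by rewrite cardsCs setCK T16 -card_IJ subn_gt0.
  by case/card_gt0P => j; rewrite inE; exists j.
have : minor a i0 j0 = 0.
  apply: big1 => s /eqP si0.
  have [|i iI siJ] := @crossing_perm T I J s card_IJ.
    by exists i0; rewrite si0 i0I (negPf j0J).
  rewrite (bigD1 i) /=; last by apply: contraNneq iI => ->.
  by rewrite zero // mul0r.
move=> m0; have := minor_ge i0 j0; rewrite m0.
by have := Xin i0I; have := Zout j0J; move: g_gt0 p_ge0; lra.
Qed.

Let p_gt0 : 0 < p. Proof. exact: lt_le_trans g_gt0 gap_le. Qed.

Let respects (s : {perm T}) := [forall i, (s i \in J) == (i \in I)].
(** The permanent of the block diagonal part of a. *)
Let p0 := \sum_(s : {perm T} | respects s) \prod_i a i (s i).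

(** A permutation lost in p0 passes through a low row and a high column, where
    the first-order condition bounds the minor by p; so the loss is at most p
    times the leak. *)
Let p0_ge : (1 - 1 / 50) * p <= p0.
Proof.
have split_p : p = p0 + \sum_(s : {perm T} | ~~ respects s) \prod_i a i (s i).
  by rewrite /permanent (bigID respects).
suff : \sum_(s : {perm T} | ~~ respects s) \prod_i a i (s i) <= 1 / 50 * p.
  by move: split_p; lra.
apply: (@le_trans _ _ (\sum_i \sum_j (if (i \in I) == (j \in J) then 0 else a i j) * p));
  last first.
  apply: (@le_trans _ _ (leak * p)).
    by rewrite /leak mulr_suml; apply: ler_sum => i _; rewrite mulr_suml.
  by apply: ler_wpM2r.
apply: (@le_trans _ _ (\sum_(i in ~: I) \sum_(j in J) a i j * minor a i j)).
  rewrite (eq_bigr (fun i => \sum_(j in J) \sum_(s : {perm T} | s i == j)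
     \prod_k a k (s k))); last first.
    move=> i _; apply: eq_bigr => j _; rewrite /minor mulr_sumr.
    by apply: eq_bigr => s /eqP <-; rewrite [RHS](bigD1 i).
  rewrite (eq_bigr (fun i => \sum_(s : {perm T} | s i \in J) \prod_k a k (s k))).
    rewrite (exchange_big_dep predT) //= [leLHS]big_mkcond; apply: ler_sum => s _.
    have w0 : 0 <= \prod_k a k (s k) by apply: prodr_ge0.
    case: ifPn => [|_]; last by apply: sumr_ge0.
    rewrite negb_forall => /existsP[i0 si0].
    have [|i iI siJ] := @crossing_perm T I J s card_IJ; first by exists i0.
    rewrite [leRHS](bigD1 i) /=; first by rewrite lerDl; apply: sumr_ge0.
    by rewrite in_setC iI siJ.
  move=> i _; rewrite [RHS](partition_big (fun s : {perm T} => s i) (mem J)) //=.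
  apply: eq_bigr => j jJ; apply: eq_bigl => s.
  by apply/eqP/andP => [->|[_ /eqP]].
rewrite big_mkcond; apply: ler_sum => i _; rewrite inE; case: ifP => /= iI; last first.
  apply: sumr_ge0 => j _; rewrite mulr_ge0 //; case: ifP => //.
rewrite big_mkcond; apply: ler_sum => j _; rewrite (negPf iI).
case: ifP => jJ /=; last by rewrite mul0r.
rewrite minorE; apply: ler_wpM2l => //.
by have := Xout iI; have := Zin jJ; move: g_gt0; lra.
Qed.

(** The normalized products a k (s k) over the block-respecting permutations have
    doubly stochastic marginals Q.  By the first-order conditions a dominates Q
    up to factors kappa (1 + (X i - Z j) / p), whose total cost is controlled by
    the energy, so capacity_blocks gives a permanent of at least
    2 eps (6 / 10) > eps, against p <= eps. *)
Lemma gap_cut_absurd : False.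
Proof.
have p00 : 0 < p0 by apply: lt_le_trans p0_ge; rewrite mulr_gt0 //; lra.
have [t0 t0P] : exists s, respects s.
  apply/existsP; apply: contraTT p00; rewrite negb_exists => /forallP H.
  by rewrite /p0 big_pred0 ?ltxx // => s; apply/negbTE/H.
pose kappa := p / p0.
have k0 : 0 < kappa by rewrite divr_gt0.
pose b i j := if (i \in I) == (j \in J) then a i j else 0.
pose Q i j := (\sum_(s : {perm T} | respects s && (s i == j)) \prod_k a k (s k)) / p0.
have Q0 i j : 0 <= Q i j.
  by rewrite divr_ge0 ?(ltW p00) //; apply: sumr_ge0 => s _; apply: prodr_ge0.
have Qr i : \sum_j Q i j = 1.
  rewrite -mulr_suml [X in X / _](_ : _ = p0) ?divff ?gt_eqF //.
  by rewrite /p0 (partition_big (fun s : {perm T} => s i) predT).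
have Qc j : \sum_i Q i j = 1.
  rewrite -mulr_suml [X in X / _](_ : _ = p0) ?divff ?gt_eqF //.
  rewrite /p0 (partition_big (fun s : {perm T} => (s^-1)%g j) predT) //=.
  apply: eq_bigr => i _; apply: eq_bigl => s; congr (_ && _).
  by apply/eqP/eqP => <-; rewrite ?permKV ?permK.
(* Within a block, Q i j * p0 counts part of the terms of
   a i j * minor a i j, which is known exactly. *)
have Qb i j : Q i j <= kappa * (1 + (X i / p - Z j / p)) * b i j.
  rewrite /b; case: ifPn => [_|ij].
    rewrite [leRHS](_ : _ = a i j * (p + X i - Z j) / p0); last first.
      by rewrite /kappa; field; rewrite !gt_eqF.
    rewrite -minorE ler_pM2r ?invr_gt0 // /minor mulr_sumr.
    rewrite [leRHS](bigID respects) /= ler_wpDr //.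
      by apply: sumr_ge0 => s _; rewrite mulr_ge0 // prodr_ge0.
    rewrite le_eqVlt; apply/orP; left; apply/eqP; apply: eq_big => [s|s].
      by rewrite andbC.
    by case/andP=> _ /eqP <-; rewrite (bigD1 i).
  rewrite mulr0 /Q big_pred0 ?mul0r // => s; apply/negbTE; apply: contra ij.
  by case/andP=> /forallP/(_ i) + /eqP <-; rewrite eq_sym.
(* The energy is at most g^2 / 50 <= p^2 / 50, by gap_le. *)
have bound : (\sum_i X i / p) - (\sum_j Z j / p) <= 1 / 50.
  have := energy_sum_potential r_gt0 c_gt0 a_sumT minorE.
  rewrite -!mulr_suml -mulrBl ler_pdivrMr // => E.
  rewrite -(ler_pM2l p_gt0) E; apply: le_trans energy_small _.
  rewrite [leRHS]mulrCA ler_pM2l ?divr_gt0 // expr2.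
  by apply: ler_pM => //; exact: ltW.
have b0 i j : 0 <= b i j by rewrite /b; case: ifP.
have amgm := doubly_stochastic_amgm b0 Q0 Qr Qc k0 Qb.
set k := #|I|; set l := #|~: I|.
have kl : (k + l = 16)%N by rewrite /k /l cardsC T16.
pose M : R := (k`! * l`!)%:R / (k ^ k * l ^ l)%:R.
have l0 : (0 < l)%N by rewrite /l cardsCs setCK T16 subn_gt0.
have kkll : 0 < (k ^ k * l ^ l)%:R :> R by rewrite ltr0n muln_gt0 !expn_gt0 I_gt0 l0.
have M0 : 0 < M by rewrite divr_gt0 // ltr0n muln_gt0 !fact_gt0.
have : M * (49 / 50) / kappa ^+ 16 <= p.
  apply: (@capacity_blocks R T a I J t0) => // [i|x x0].
    by have /forallP/(_ i)/eqP := t0P.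
  rewrite -/k -/l.
  have := amgm x x0; rewrite T16.
  rewrite (_ : \prod_j row_comb b setT x j = \prod_(j in J) row_comb a I x j *
      \prod_(j in ~: J) row_comb a (~: I) x j); last first.
    rewrite (bigID (mem J)) /=; congr (_ * _).
      apply: eq_bigr => j jJ; rewrite /row_comb big_mkcond [RHS]big_mkcond.
      by apply: eq_bigr => i _; rewrite inE /b jJ eqb_id; case: ifP => _; rewrite ?mulr0.
    apply: eq_big => [j|j jJ]; first by rewrite in_setC.
    rewrite /row_comb big_mkcond [RHS]big_mkcond.
    apply: eq_bigr => i _; rewrite in_setT in_setC /b (negPf jJ) eqbF_neg.
    by case: ifP => //= _; rewrite mulr0.
  set PP := _ * \prod_(j in ~: J) _.
  have Px : 0 < \prod_i x i by apply: prodr_gt0.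
  have k16 : 0 < kappa ^+ 16 by rewrite exprn_gt0.
  move=> H.
  have {}H : 49 / 50 * \prod_i x i <= kappa ^+ 16 * PP.
    apply: le_trans _ H; rewrite ler_pM2r // lerBrDr -lerBrDl.
    by apply: le_trans bound _; lra.
  rewrite /M.
  rewrite [leLHS](_ : _ = (k`! * l`!)%:R * ((49 / 50 * \prod_i x i) / kappa ^+ 16)).
    by rewrite ler_pM2l ?ltr0n ?muln_gt0 ?fact_gt0 // ler_pdivrMr // [leRHS]mulrC.
  move: (_%:R) (kappa ^+ 16) (\prod_i x i) kkll k16 => D kap px D0 kap0.
  by field; rewrite !gt_eqF.
apply/negP; rewrite -ltNge; apply: le_lt_trans p_le _.
have kap : kappa <= 50 / 49.
  by rewrite ler_pdivrMr //; move: p0_ge; lra.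
have M2 : 2 * eps <= M by exact: fact_exp_split_ge.
have kap16 : 49 / 50 / kappa ^+ 16 > 6 / 10.
  have ik : 1 - 1 / 50 <= kappa^-1.
    by rewrite -[kappa^-1]mul1r ler_pdivlMr //; move: kap; lra.
  have := @bernoulli_le R (1 / 50) 16; have : (1 - 1 / 50) ^+ 16 <= kappa^-1 ^+ 16.
    by apply: lerXn2r => //; rewrite nnegrE; lra.
  rewrite exprVn; move: ((1 - 1 / 50) ^+ 16) => u h1 h2.
  by have {h2} := h2 _; lra.
have eps_gt0 : 0 < eps := fact_exp_gt0 R (isT : (0 < 16)%N).
rewrite -mulrA; apply: (@lt_le_trans _ _ (2 * eps * (6 / 10))); first by lra.
apply: ler_pM => //; [by apply: mulr_ge0 => //; exact: ltW|lra|exact: ltW].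
Qed.

End Cut.

Lemma potentials_eq0 : (forall i, X i = 0) /\ (forall j, Z j = 0).
Proof.
pose v (u : T + T) := match u with inl i => X i | inr j => Z j end.
have [vc|] := boolP [forall u, forall w, v u == v w]; last first.
  rewrite negb_forall => /existsP[u0]; rewrite negb_forall => /existsP[w0 uw].
  have [t [g [g0 gap [u ut] [w wt] rng]]] := exists_gap uw.
  have rng' x y : v x - v y <= 31 * g.
    by have := rng x y; rewrite card_sum T16.
  exfalso; apply: (@gap_cut_absurd t g) => //.
  - by move=> i; exact: (gap (inl i)).
  - by move=> j; exact: (gap (inr j)).
  - by move=> i k; exact: (rng' (inl i) (inl k)).
  - by move=> i k; exact: (rng' (inr i) (inr k)).
  - case: u ut => x xt; rewrite addn_gt0; apply/orP; [left|right];
      by apply/card_gt0P; exists x; rewrite inE.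
  - have lt16 (Y : T -> R) x : Y x <= t - g -> (#|[set i | (t <= Y i)%R]| < 16)%N.
      move=> Yx; rewrite -T16 -cardsT; apply: proper_card; rewrite properT.
      apply/negP => /eqP/setP/(_ x); rewrite !inE => tY.
      by move: Yx g0 tY; lra.
    have le16 (S : {set T}) : (#|S| <= 16)%N by rewrite -T16 max_card.
    case: w wt => x xt.
      by rewrite -addSn -[32%N]/(16 + 16)%N leq_add // (lt16 X x).
    by rewrite -addnS -[32%N]/(16 + 16)%N leq_add // (lt16 Z x).
have vE u w : v u = v w by have /forallP/(_ u)/forallP/(_ w)/eqP := vc.
have X0 i : X i = 0.
  have : \sum_k r k * X k = 0 := sum_row_potential rp r_gt0 a_sumT.
  have -> : \sum_k r k * X k = \sum_k r k * X i.
    by apply: eq_bigr => k _; congr (_ * _); exact: (vE (inl k) (inl i)).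
  by rewrite -mulr_suml a_sum => /eqP; rewrite mulf_eq0 => /orP[|/eqP //]; lra.
by split=> // j; have -> : Z j = X j := vE (inr j) (inl j).
Qed.

End NonUniformPotentials.

(** * Doubly stochastic matrices *)

Section DoublyStochastic.
Variables (R : realType) (T : finType) (a : T -> T -> R).
Hypothesis a_ge0 : forall i j, 0 <= a i j.
Hypothesis rows1 : forall i, \sum_j a i j = 1.
Hypothesis cols1 : forall j, \sum_i a i j = 1.

(** The capacity bound with a single block: a doubly stochastic array has capacity
    at least 1, by AM-GM with weights a itself. *)
Lemma van_der_waerden : (#|T|)`!%:R / #|T|%:R ^+ #|T| <= permanent a.
Proof.
apply: (@capacity_blocks R T a setT setT 1%g) => // [i|x x0].
  by rewrite !inE.
have Qa i j : a i j <= 1 * (1 + (0 - 0)) * a i j by rewrite subr0 addr0 !mul1r.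
have H := doubly_stochastic_amgm (X := fun=> 0) (Z := fun=> 0)
  a_ge0 a_ge0 rows1 cols1 ltr01 Qa x0.
rewrite !big1_eq !subr0 mul1r expr1n mul1r in H.
rewrite setCT cards0 cardsT fact0 !muln1 big_set0 mulr1 natrX divfK; last first.
  have [T0|T0] := eqVneq #|T| 0%N; first by rewrite T0 expr0 oner_eq0.
  by rewrite expf_neq0 // pnatr_eq0.
rewrite ler_wpM2l //; apply: le_trans H _.
by rewrite le_eqVlt; apply/orP; left; apply/eqP; apply: eq_bigl => j; rewrite in_setT.
Qed.

(** Egorychev's argument: if some minor in row k is too large, then replacing row k
    by a row i that meets its column gives a permanent larger than p, while the
    opposite replacement gives at least p, against the Alexandrov inequality. *)
Lemma minor_const : 0 < permanent a -> (forall i j, permanent a <= minor a i j) ->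
  (forall i j, 0 < a i j -> minor a i j = permanent a) ->
  forall i j, minor a i j = permanent a.
Proof.
move=> p0 m_ge m_eq k j; apply/eqP; rewrite eq_le m_ge andbT leNgt; apply/negP => mkj.
have akj : a k j = 0.
  apply/eqP; rewrite eq_le a_ge0 andbT leNgt; apply/negP => /m_eq E.
  by rewrite E ltxx in mkj.
have [i aij] : exists i, 0 < a i j.
  apply/existsP; apply: contraT; rewrite negb_exists => /forallP H.
  have := cols1 j; rewrite big1 => [/eqP|i _]; first by rewrite eq_sym oner_eq0.
  by apply/eqP; rewrite eq_le a_ge0 andbT leNgt.
have ik : i != k by apply: contraTneq aij => ->; rewrite akj ltxx.
have rep_ge h h' : permanent a <= permanent (set_row a h (a h')).
  rewrite permanent_row -[leLHS]mul1r -(rows1 h') mulr_suml; apply: ler_sum => l _.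
  by rewrite ler_wpM2l.
have rep_gt : permanent a < permanent (set_row a k (a i)).
  rewrite permanent_row -[ltLHS]mul1r -(rows1 i) mulr_suml (bigD1 j) //= [ltRHS](bigD1 j) //=.
  apply: ltr_leD; first by rewrite ltr_pM2l.
  by apply: ler_sum => l _; rewrite ler_wpM2l.
have := alexandrov a_ge0 (a_ge0 i) (a_ge0 k) ik.
have -> : permanent (set_row (set_row a i (a i)) k (a i)) = permanent (set_row a k (a i)).
  by apply: eq_permanent => h l; rewrite /set_row; case: eqP => // _; case: eqP => [->|].
have -> : permanent (set_row (set_row a i (a k)) k (a k)) = permanent (set_row a i (a k)).
  apply: eq_permanent => h l; rewrite /set_row; case: eqP => [->|//].
  by rewrite eq_sym (negPf ik).
have -> : permanent (set_row (set_row a i (a i)) k (a k)) = permanent a.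
  by apply: eq_permanent => h l; rewrite /set_row; case: eqP => [->//|_]; case: eqP => [->|].
apply/negP; rewrite -ltNge expr2.
by have := rep_ge i k; move: p0 rep_gt; nra.
Qed.

End DoublyStochastic.

Lemma permanent_average_rows (R : realType) (T : finType) (a : T -> T -> R)
    (u v : T) (p : R) :
  u != v -> (forall i, \sum_j a i j = 1) -> (forall i j, minor a i j = p) ->
  let w := fun j => (a u j + a v j) / 2 in
  permanent (set_row (set_row a u w) v w) = p.
Proof.
move=> uv rows1 mp w.
have half b i x y : permanent (set_row b i (fun j => (x j + y j) / 2)) =
    (permanent (set_row b i x) + permanent (set_row b i y)) / 2 :> R.
  rewrite !permanent_row -big_split mulr_suml; apply: eq_bigr => j _ /=. by field.
have unit_row (h : T) (x : T -> R) : \sum_j x j = 1 -> permanent (set_row a h x) = p.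
  move=> x1; rewrite permanent_row (eq_bigr _ (fun j _ => congr1 _ (mp h j))).
  by rewrite -mulr_suml x1 mul1r.
have w1 : \sum_j w j = 1.
  by rewrite /w -mulr_suml big_split /= !rows1; field.
rewrite {2}/w half -(permanent_rowC a (a u) w uv).
have -> : permanent (set_row (set_row a u (a u)) v w) = permanent (set_row a v w).
  by apply: eq_permanent => h l; rewrite /set_row; case: eqP => // _; case: eqP => [->|].
have -> : permanent (set_row (set_row a u w) v (a v)) = permanent (set_row a u w).
  by apply: eq_permanent => h l; rewrite /set_row; case: eqP => [->|//]; rewrite eq_sym (negPf uv).
by rewrite !unit_row //; field.
Qed.

(** If all rows but row l equal b, then b j * minor a l j is the product of the b k
    times the number of permutations sending l to j, which does not depend
    on j. *)
Lemma common_row_const (R : realType) (T : finType) (a : T -> T -> R) (l : T)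
    (b : T -> R) (p : R) :
  (forall i j, i != l -> a i j = b j) -> 0 < p -> \sum_j b j = 1 ->
  (forall j, minor a l j = p) -> forall j j', b j = b j'.
Proof.
move=> ab p0 b1 mp.
pose N j := #|[set s : {perm T} | s l == j]|.
have E j : b j * p = (\prod_k b k) *+ N j.
  rewrite -(mp j) /minor mulr_sumr /N -sumr_const; apply: eq_big => [s|s /eqP slj].
    by rewrite inE.
  rewrite [RHS](reindex_inj (@perm_inj _ s)) [RHS](bigD1 l) //= slj.
  by congr (_ * _); apply: eq_bigr => k kl; rewrite ab.
have NN j j' : N j = N j'.
  rewrite /N -(card_imset _ (mulIg (tperm j j'))); apply: eq_card => s.
  rewrite inE; apply/imsetP/eqP => [[s' + ->]|sl].
    by rewrite inE permM => /eqP ->; rewrite tpermL.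
  exists (s * tperm j j')%g; last by rewrite -mulgA tperm2 mulg1.
  by rewrite inE permM sl tpermR.
move=> j j'; apply: (mulIf (lt0r_neq0 p0)).
by rewrite !E (NN j j').
Qed.

(** * First-order conditions for maximizers *)

Definition maximizer (R : realType) n (A : 'M[R]_n) :=
  K A /\ forall B : 'M[R]_n, K B -> Phi B <= Phi A.

Lemma expr1D_geom (F : comPzRingType) (u : F) n :
  (1 + u) ^+ n = 1 + u * \sum_(k < n) (1 + u) ^+ k.
Proof.
by have := subrX1 (1 + u) n; rewrite addrAC subrr add0r => <-; rewrite [RHS]addrC subrK.
Qed.

Section FirstOrder.
Variables (R : realType) (n : nat).
Hypothesis n_gt0 : (0 < n)%N.
Implicit Types (A B : 'M[R]_n).

Let nR_gt0 : 0 < n%:R :> R. Proof. by rewrite ltr0n. Qed.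

Definition gradient A i j :=
  \prod_(k | k != i) rowsum A k + \prod_(l | l != j) colsum A l - minor A i j.

Lemma PhiZ x A : Phi (x *: A) = x ^+ n * Phi A.
Proof.
rewrite /Phi mulrBr mulrDr; congr (_ + _ - _).
- rewrite -[X in x ^+ X]card_ord -prodr_const -big_split; apply: eq_bigr => i _ /=.
  by rewrite /rowsum mulr_sumr; apply: eq_bigr => j _; rewrite mxE.
- rewrite -[X in x ^+ X]card_ord -prodr_const -big_split; apply: eq_bigr => i _ /=.
  by rewrite /colsum mulr_sumr; apply: eq_bigr => j _; rewrite mxE.
rewrite /per mulr_sumr; apply: eq_bigr => s _.
rewrite -[X in x ^+ X]card_ord -prodr_const -big_split; apply: eq_bigr => i _ /=.
by rewrite mxE.
Qed.

(** The functional is homogeneous, so a maximizer also controls nonnegative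
    matrices with another sum. *)
Lemma Phi_homogeneous_le A B t : maximizer A -> (forall i j, 0 <= B i j) ->
  0 < t -> \sum_i \sum_j B i j = t * n%:R -> Phi B <= t ^+ n * Phi A.
Proof.
move=> [_ Amax] B0 t0 sB.
have -> : B = t *: (t^-1 *: B) by rewrite scalerA divff ?scale1r // gt_eqF.
rewrite PhiZ ler_pM2l ?exprn_gt0 //; apply: Amax; split=> [i j|].
  by rewrite mxE mulr_ge0 // invr_ge0 ltW.
rewrite (eq_bigr (fun i => t^-1 * \sum_j B i j)) => [|i _].
  by rewrite -mulr_sumr sB mulKf // gt_eqF.
by rewrite mulr_sumr; apply: eq_bigr => j _; rewrite mxE.
Qed.

Lemma Phi_add_delta A t i j :
  Phi (A + t *: delta_mx i j) = Phi A + t * gradient A i j.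
Proof.
have rE k : rowsum (A + t *: delta_mx i j) k = rowsum A k + t * (k == i)%:R.
  rewrite /rowsum (eq_bigr (fun l => A k l + t * ((k == i) && (l == j))%:R)).
    rewrite big_split /= -mulr_sumr; congr (_ + _ * _).
    rewrite (bigD1 j) //= eqxx andbT big1 ?addr0 // => l /negPf ->.
    by rewrite andbF.
  by move=> l _; rewrite !mxE.
have cE k : colsum (A + t *: delta_mx i j) k = colsum A k + t * (k == j)%:R.
  rewrite /colsum (eq_bigr (fun l => A l k + t * ((l == i) && (k == j))%:R)).
    rewrite big_split /= -mulr_sumr; congr (_ + _ * _).
    rewrite (bigD1 i) //= eqxx big1 ?addr0 // => l /negPf ->.
    by [].
  by move=> l _; rewrite !mxE.
have prodE (w : 'I_n -> R) h : \prod_k (w k + t * (k == h)%:R) =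
    \prod_k w k + t * \prod_(k | k != h) w k.
  rewrite (bigD1 h) //= eqxx mulr1 [in RHS](bigD1 h) //= -mulrDl; congr (_ * _).
  by apply: eq_bigr => k /negPf ->; rewrite mulr0 addr0.
have pE : per (A + t *: delta_mx i j) = per A + t * minor A i j.
  have -> : per A = permanent (set_row A i (A i)) by rewrite permanent_row_id.
  have -> : minor A i j = permanent (set_row A i (fun l => (l == j)%:R)).
    rewrite permanent_row (bigD1 j) //= eqxx mul1r big1 ?addr0 // => l /negPf ->.
    by rewrite mul0r.
  rewrite -permanent_rowD; apply: eq_permanent => k l; rewrite !mxE /set_row.
  by case: eqP => [->|_] //=; rewrite mulr0 addr0.
rewrite /Phi pE (eq_bigr _ (fun k _ => rE k)) (eq_bigr _ (fun k _ => cE k)).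
by rewrite !prodE /gradient; ring.
Qed.

Lemma maximizer_perturb A i j t : maximizer A -> 0 <= A i j + t -> - n%:R < t ->
  Phi A + t * gradient A i j <= (1 + t / n%:R) ^+ n * Phi A.
Proof.
move=> Amax; have [[A0 sA] _] := Amax => Aij tn.
rewrite -Phi_add_delta; apply: Phi_homogeneous_le => //.
- move=> k l; rewrite !mxE; case: eqP => [->|_] /=; last by rewrite mulr0 addr0.
  by case: eqP => [->|_]; rewrite ?mulr1 ?mulr0 ?addr0.
- by rewrite -(ltr_pM2r nR_gt0) mul0r mulrDl mul1r divfK ?gt_eqF //; lra.
rewrite mulrDl mul1r divfK ?gt_eqF // -sA.
rewrite (eq_bigr (fun k => \sum_l A k l + t * (k == i)%:R)) => [|k _].
  rewrite big_split /=; congr (_ + _); rewrite -mulr_sumr (bigD1 i) //= eqxx big1.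
    by rewrite addr0 mulr1.
  by move=> k /negPf ->.
rewrite (eq_bigr (fun l => A k l + t * ((k == i) && (l == j))%:R)) => [|l _].
  rewrite big_split /= -mulr_sumr; congr (_ + _ * _).
  rewrite (bigD1 j) //= eqxx andbT big1 ?addr0 // => l /negPf ->.
  by rewrite andbF.
by rewrite !mxE.
Qed.

(** Raise one entry by e: the functional gains e times the partial derivative,
    exactly, and homogeneity allows (1 + e / n) ^ n - 1 times its value.  Divide
    by e and let e tend to 0. *)
Lemma gradient_le A i j : maximizer A -> gradient A i j <= Phi A.
Proof.
move=> Amax; rewrite -subr_ge0.
pose q : {poly R} := (Phi A / n%:R)%:P * \sum_(k < n) (1 + n%:R^-1 *: 'X) ^+ k
  - (gradient A i j)%:P.
have qE e : q.[e] = Phi A / n%:R * (\sum_(k < n) (1 + e / n%:R) ^+ k) - gradient A i j.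
  rewrite /q !hornerE horner_sum; congr (_ * _ - _); apply: eq_bigr => k _.
  by rewrite !hornerE mulrC.
have : 0 <= q.[0].
  apply: (horner0_ge0 ltr01) => e /andP[e0 _]; rewrite qE -(pmulr_rge0 _ e0).
  have [[A0 _] _] := Amax.
  have := @maximizer_perturb A i j e Amax.
  rewrite addr_ge0 // ?(ltW e0) // => /(_ isT).
  have -> : - n%:R < e by apply: lt_trans e0; rewrite oppr_lt0.
  move=> /(_ isT); rewrite -subr_ge0; congr (0 <= _).
  have -> : (1 + e / n%:R) ^+ n = 1 + e / n%:R * \sum_(k < n) (1 + e / n%:R) ^+ k.
    exact: expr1D_geom.
  by ring.
rewrite qE; congr (0 <= _).
rewrite (eq_bigr (fun=> 1)) => [|k _]; last by rewrite mul0r addr0 expr1n.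
by rewrite sumr_const card_ord divfK // gt_eqF.
Qed.

(** A positive entry can also be lowered. *)
Lemma gradient_eq A i j : maximizer A -> 0 < A i j -> gradient A i j = Phi A.
Proof.
move=> Amax Aij; apply/eqP; rewrite eq_le gradient_le //= -subr_ge0.
pose q : {poly R} := (gradient A i j)%:P -
   (Phi A / n%:R)%:P * \sum_(k < n) (1 - n%:R^-1 *: 'X) ^+ k.
have qE e : q.[e] = gradient A i j - Phi A / n%:R * (\sum_(k < n) (1 - e / n%:R) ^+ k).
  rewrite /q !hornerE horner_sum; congr (_ - _ * _); apply: eq_bigr => k _.
  by rewrite !hornerE mulrC.
have m0 : 0 < Num.min (A i j) n%:R by rewrite lt_min Aij.
have : 0 <= q.[0].
  apply: (horner0_ge0 m0) => e; rewrite lt_min => /and3P[e0 eA en].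
  rewrite qE -(pmulr_rge0 _ e0).
  have := @maximizer_perturb A i j (- e) Amax.
  rewrite subr_ge0 (ltW eA) ltrN2 en => /(_ isT isT).
  rewrite -subr_ge0; congr (0 <= _).
  have -> : (1 + - e / n%:R) ^+ n = 1 - e / n%:R * \sum_(k < n) (1 - e / n%:R) ^+ k.
    by rewrite mulNr expr1D_geom mulNr.
  by ring.
rewrite qE; congr (0 <= _).
rewrite (eq_bigr (fun=> 1)) => [|k _]; last by rewrite mul0r subr0 expr1n.
by rewrite sumr_const card_ord divfK // gt_eqF.
Qed.

End FirstOrder.

(** * Extreme values on the simplex of matrices *)

Section ExtremeValue.
Import numFieldNormedType.Exports.
Local Open Scope classical_set_scope.
Variables (R : realType) (n : nat).
Implicit Types (A B : 'M[R]_n) (f g : 'M[R]_n -> R).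

(** Continuity after flattening to row vectors, where a box is compact as a product
    of segments. *)
Definition mx_continuous f := continuous (fun v : 'rV[R]_(n * n) => f (vec_mx v)).

Lemma mx_continuous_entry i j : mx_continuous (fun A => A i j).
Proof.
rewrite /mx_continuous.
have -> : (fun v : 'rV[R]_(n * n) => vec_mx v i j) =
    (fun v : 'rV[R]_(n * n) => v ord0 (mxvec_index i j)).
  by apply/funext => v; rewrite mxE.
exact: coord_continuous.
Qed.

Lemma mx_continuous_cst c : mx_continuous (fun=> c).
Proof. exact: cst_continuous. Qed.

Lemma mx_continuousD f g : mx_continuous f -> mx_continuous g ->
  mx_continuous (fun A => f A + g A).
Proof. by move=> cf cg v; exact: (cvgD (cf v) (cg v)). Qed.

Lemma mx_continuousN f : mx_continuous f -> mx_continuous (fun A => - f A).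
Proof. by move=> cf v; exact: (cvgN (cf v)). Qed.

Lemma mx_continuousM f g : mx_continuous f -> mx_continuous g ->
  mx_continuous (fun A => f A * g A).
Proof. by move=> cf cg v; exact: (cvgM (cf v) (cg v)). Qed.

Lemma mx_continuous_sqrB f c : mx_continuous f ->
  mx_continuous (fun A => (f A - c) ^+ 2).
Proof.
move=> cf; have cfc := mx_continuousD cf (@mx_continuous_cst (- c)).
exact: (mx_continuousM cfc cfc).
Qed.

Lemma mx_continuous_sum (I : finType) (f : I -> 'M[R]_n -> R) :
  (forall i, mx_continuous (f i)) -> mx_continuous (fun A => \sum_i f i A).
Proof. by move=> cf; apply: continuous_big => [|i _]; [exact: add_continuous|exact: cf]. Qed.

Lemma mx_continuous_prod (I : finType) (f : I -> 'M[R]_n -> R) :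
  (forall i, mx_continuous (f i)) -> mx_continuous (fun A => \prod_i f i A).
Proof. by move=> cf; apply: continuous_big => [|i _]; [exact: mul_continuous|exact: cf]. Qed.

Lemma mx_continuous_Phi : mx_continuous (@Phi R n).
Proof.
apply: mx_continuousD; first apply: mx_continuousD.
- apply: mx_continuous_prod => i; apply: mx_continuous_sum => j.
  exact: mx_continuous_entry.
- apply: mx_continuous_prod => i; apply: mx_continuous_sum => j.
  exact: mx_continuous_entry.
apply: mx_continuousN; apply: mx_continuous_sum => s.
by apply: mx_continuous_prod => i; exact: mx_continuous_entry.
Qed.

Lemma K_entry_le A i j : K A -> A i j <= n%:R.
Proof.
case=> A0 <-; rewrite (bigD1 i) //= (bigD1 j) //= -addrA lerDl addr_ge0 //.
  by rewrite sumr_ge0.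
by apply: sumr_ge0 => k _; apply: sumr_ge0.
Qed.

(** The constraint g = 0 serves to fix some entries and the value of the
    functional in a second optimization among maximizers. *)
Lemma K_extreme_value f g A : mx_continuous f -> mx_continuous g ->
  K A -> g A = 0 ->
  exists B, [/\ K B, g B = 0 & forall C, K C -> g C = 0 -> f C <= f B].
Proof.
move=> cf cg KA gA.
pose h B := \sum_i \sum_j B i j.
have ch : mx_continuous h.
  by apply: mx_continuous_sum => i; apply: mx_continuous_sum => j;
    exact: mx_continuous_entry.
pose box := [set v : 'rV[R]_(n * n) | forall i, 0 <= v ord0 i <= n%:R].
pose D := box `&` ([set v | h (vec_mx v) = n%:R] `&` [set v | g (vec_mx v) = 0]).
have cD : compact D.
  apply: compact_closedI; last apply: closedI.
  - have -> : box = [set v | forall i, `[0, n%:R]%classic (v ord0 i)].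
      by apply/seteqP; split=> v bv i; have := bv i; rewrite /= in_itv.
    have := @rV_compact _ (n * n) (fun=> `[0 : R, n%:R]%classic).
    by apply=> i; exact: segment_compact.
  - by apply: (@closed_comp _ _ (fun v => h (vec_mx v)) [set x | x = n%:R]);
      [move=> v _; exact: ch|exact: closed_eq].
  - by apply: (@closed_comp _ _ (fun v => g (vec_mx v)) [set x | x = 0]);
      [move=> v _; exact: cg|exact: closed_eq].
have DE B : K B -> g B = 0 -> D (mxvec B).
  move=> KB gB; split; last by split; rewrite /= mxvecK //; case: KB.
  move=> k; case/mxvec_indexP: k => i j; rewrite mxvecE K_entry_le // andbT.
  by case: KB.
have KE v : D v -> K (vec_mx v) /\ g (vec_mx v) = 0.
  case=> bv [hv gv]; split=> //; split=> // i j; rewrite mxE.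
  by have := bv (mxvec_index i j); case/andP.
have [||v vD vmax] := @compact_EVT_max _ R (fun v => f (vec_mx v)) D _ cD.
- by exists (mxvec A); exact: DE.
- exact: continuous_subspaceT.
move: vD; rewrite in_setE => /KE[Kv gv].
exists (vec_mx v); split=> // C KC gC.
by have := vmax (mxvec C); rewrite mxvecK; apply; rewrite in_setE; exact: DE.
Qed.

End ExtremeValue.

(** * Maximizers of the Dittert functional *)

Section Maximizers.
Variable R : realType.
Implicit Types A B : 'M[R]_16.
Local Notation eps := (16`!%:R / 16 ^+ 16 : R).

Lemma Phi_uniform : Phi (U R 16) = 2 - eps.
Proof.
rewrite /Phi /U.
have s1 : \sum_(j < 16) (1 / 16 : R) = 1 by rewrite sumr_const card_ord -mulr_natl; field.
have -> : \prod_i rowsum (const_mx (1 / 16%:R) : 'M[R]_16) i = 1.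
  rewrite big1 // => i _; rewrite -[RHS]s1; apply: eq_bigr => j _; by rewrite mxE.
have -> : \prod_i colsum (const_mx (1 / 16%:R) : 'M[R]_16) i = 1.
  rewrite big1 // => i _; rewrite -[RHS]s1; apply: eq_bigr => j _; by rewrite mxE.
have -> : per (const_mx (1 / 16%:R) : 'M[R]_16) = eps.
  rewrite /per (eq_bigr (fun=> (1 / 16) ^+ 16)) => [|s _].
    by rewrite sumr_const card_Sn -[LHS]mulr_natl expr_div_n expr1n mul1r.
  rewrite (eq_bigr (fun=> 1 / 16)) => [|i _]; last by rewrite mxE.
  by rewrite prodr_const card_ord.
by [].
Qed.

Lemma U_in_K : K (U R 16).
Proof.
split=> [i j|]; first by rewrite mxE divr_ge0 // ler0n.
have s1 : \sum_(j < 16) (1 / 16 : R) = 1 by rewrite sumr_const card_ord -mulr_natl; field.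
rewrite (eq_bigr (fun=> 1)) => [|i _]; first by rewrite sumr_const card_ord.
by rewrite -[RHS]s1; apply: eq_bigr => j _; rewrite mxE.
Qed.

(** Comparison with the uniform matrix puts the products of the row and of the
    column sums within eps of 1 and the permanent at most eps; the first-order
    conditions then make all potentials 0, that is, all sums 1.  For zero
    potentials they are the hypotheses of minor_const. *)
Lemma maximizer_doubly_stochastic A : maximizer A ->
  [/\ forall i, rowsum A i = 1, forall j, colsum A j = 1,
      0 < per A & forall i j, minor A i j = per A].
Proof.
move=> Amax; have [[A0 sA] Am] := Amax.
set r := rowsum A; set c := colsum A.
have r0 i : 0 <= r i by apply: sumr_ge0.
have c0 j : 0 <= c j by apply: sumr_ge0.
have rs : \sum_i r i = #|'I_16|%:R by rewrite card_ord.
have cs : \sum_j c j = #|'I_16|%:R by rewrite card_ord -sA exchange_big.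
have rp1 := prod_le1 r0 rs; have cp1 := prod_le1 c0 cs.
have p0 : 0 <= per A by apply: permanent_ge0.
have := Am _ U_in_K; rewrite Phi_uniform /Phi -/r -/c.
set rp := \prod_i r i in rp1 *; set cp := \prod_j c j in cp1 * => Phi_ge.
have e1 : eps <= (1 / 900) ^+ 2 := eps16 R.
have rp_near : 1 - eps <= rp by move: cp1 p0 Phi_ge; lra.
have cp_near : 1 - eps <= cp by move: rp1 p0 Phi_ge; lra.
have p_le : per A <= eps by move: rp1 cp1 Phi_ge; lra.
have pos (w : 'I_16 -> R) i : (forall i, 0 <= w i) -> 1 - eps <= \prod_i w i -> 0 < w i.
  move=> w0 wp; rewrite lt_def w0 andbT; apply: contraTneq wp => wi.
  by rewrite (bigD1 i) //= wi mul0r -ltNge; move: e1; lra.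
have r_gt0 i : 0 < r i by apply: pos rp_near.
have c_gt0 j : 0 < c j by apply: pos cp_near.
have gE i j : gradient A i j = rp / r i + cp / c j - minor A i j.
  rewrite /gradient; congr (_ + _ - _).
    by rewrite /rp [in RHS](bigD1 i) //= mulrC mulKf // gt_eqF.
  by rewrite /cp [in RHS](bigD1 j) //= mulrC mulKf // gt_eqF.
have minorgE i j : minor A i j = per A + row_potential A rp i - col_potential A cp j
    + (Phi A - gradient A i j).
  by rewrite gE /row_potential /col_potential /Phi -/r -/c -/rp -/cp /r /c /rowsum /colsum; ring.
have m_ge i j : per A + row_potential A rp i - col_potential A cp j <= minor A i j.
  by rewrite minorgE lerDl subr_ge0 gradient_le.
have m_eq i j : A i j * minor A i j =
    A i j * (per A + row_potential A rp i - col_potential A cp j).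
  have [->|Aij] := eqVneq (A i j) 0; first by rewrite !mul0r.
  by rewrite minorgE gradient_eq // ?subrr ?addr0 // lt_def Aij A0.
have [X0 Z0] := potentials_eq0 (card_ord 16) A0 r_gt0 c_gt0 sA rp_near cp_near p_le m_eq m_ge.
have rp_gt0 : 0 < rp by move: rp_near e1; lra.
have cp_gt0 : 0 < cp by move: cp_near e1; lra.
have r1 i : r i = 1.
  have /eqP := X0 i; rewrite /row_potential subr_eq0 => /eqP E.
  apply: (mulfI (lt0r_neq0 rp_gt0)); rewrite mulr1 -[X in X * _]E.
  by apply: divfK; rewrite gt_eqF //; exact: r_gt0.
have c1 j : c j = 1.
  have /eqP := Z0 j; rewrite /col_potential subr_eq0 => /eqP E.
  apply: (mulfI (lt0r_neq0 cp_gt0)); rewrite mulr1 [X in X * _]E.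
  by apply: divfK; rewrite gt_eqF //; exact: c_gt0.
have pA : 0 < per A.
  apply: lt_le_trans (van_der_waerden A0 r1 c1).
  by apply: fact_exp_gt0; rewrite card_ord.
split=> //; apply: minor_const => // [i j|i j Aij].
  by have := m_ge i j; rewrite X0 Z0 subr0 addr0.
apply: (mulfI (lt0r_neq0 Aij)); rewrite m_eq X0 Z0 subr0 addr0 //.
Qed.

(** All minors of a maximizer being equal, averaging two rows does not change the
    permanent, nor does it change the row and column sums. *)
Lemma maximizer_average A (u v : 'I_16) : maximizer A -> u != v ->
  let w := fun j => (A u j + A v j) / 2 in
  maximizer (\matrix_(i, j) set_row (set_row A u w) v w i j).
Proof.
move=> Amax uv w; have [[A0 sA] Am] := Amax.
have [r1 c1 p0 mE] := maximizer_doubly_stochastic Amax.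
set B := \matrix_(i, j) _.
have BE i j : B i j = set_row (set_row A u w) v w i j by rewrite mxE.
have B0 i j : 0 <= B i j.
  by rewrite BE /set_row /w; case: eqP => _ /=; last case: eqP => _ //=;
    rewrite divr_ge0 ?addr_ge0.
have rB i : rowsum B i = 1.
  rewrite /rowsum (eq_bigr _ (fun j _ => BE i j)) /set_row.
  have w1 : \sum_j w j = 1.
    by rewrite /w -mulr_suml big_split /=; have := r1 u; have := r1 v;
      rewrite /rowsum => -> ->; field.
  by case: eqP => _ //; case: eqP => _ //; exact: r1.
have cB j : colsum B j = 1.
  rewrite -[RHS](c1 j) /colsum (eq_bigr _ (fun i _ => BE i j)).
  have vu : v != u by rewrite eq_sym.
  rewrite (bigD1 u) //= (bigD1 v) //= [RHS](bigD1 u) //= [in RHS](bigD1 v) //=.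
  rewrite /set_row !eqxx (negPf uv) !addrA; congr (_ + _); first by rewrite /w; field.
  by apply: eq_bigr => i /andP[/negPf -> /negPf ->].
have pB : per B = per A.
  transitivity (permanent (set_row (set_row A u w) v w)); last exact: permanent_average_rows.
  by apply: eq_permanent => i j; rewrite BE.
have KB : K B.
  split=> //; rewrite (eq_bigr (fun=> 1)) => [|i _]; last exact: rB.
  by rewrite sumr_const card_ord.
split=> // C KC; rewrite (le_trans (Am C KC)) //.
by rewrite /Phi pB (eq_bigr _ (fun i _ => r1 i)) (eq_bigr _ (fun i _ => c1 i))
  (eq_bigr _ (fun i _ => rB i)) (eq_bigr _ (fun i _ => cB i)).
Qed.

(** Among the maximizers with the same row l take one with the least sum of
    squares.  Averaging two other rows would decrease that sum unless they are
    equal, so all other rows agree; by common_row_const they are uniform, and the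
    column sums make row l uniform. *)
Lemma maximizer_row_uniform A (l : 'I_16) : maximizer A -> forall j, A l j = 1 / 16.
Proof.
move=> Amax; have [KA Am] := Amax.
pose f B : R := - \sum_i \sum_j B i j ^+ 2.
pose g B : R := (Phi B - Phi A) ^+ 2 + \sum_j (B l j - A l j) ^+ 2.
have cf : mx_continuous f.
  apply: mx_continuousN; apply: mx_continuous_sum => i; apply: mx_continuous_sum => j.
  by apply: mx_continuousM; exact: mx_continuous_entry.
have cg : mx_continuous g.
  apply: mx_continuousD; first exact: (mx_continuous_sqrB (@mx_continuous_Phi _ _)).
  apply: mx_continuous_sum => j; exact: (mx_continuous_sqrB (@mx_continuous_entry _ _ _ _)).
have gP B : g B = 0 <-> Phi B = Phi A /\ forall j, B l j = A l j.
  have s0 : 0 <= \sum_j (B l j - A l j) ^+ 2 by apply: sumr_ge0 => j _; exact: sqr_ge0.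
  split=> [/eqP|[PB lB]]; last first.
    by rewrite /g PB subrr expr0n add0r big1 // => j _; rewrite lB subrr expr0n.
  rewrite paddr_eq0 ?sqr_ge0 // sqrf_eq0 subr_eq0 => /andP[/eqP -> /eqP H]; split=> // j.
  apply/eqP; rewrite -subr_eq0 -sqrf_eq0.
  by rewrite (psumr_eq0P _ H) // => k _; exact: sqr_ge0.
have gA : g A = 0 by apply/gP.
have [B [KB /gP[PB lB] Bmin]] := K_extreme_value cf cg KA gA.
have Bmax : maximizer B by split=> // C KC; rewrite PB; exact: Am.
have rows_eq u v : u != l -> v != l -> forall j, B u j = B v j.
  move=> ul vl j; apply/eqP; apply: contraT => uvj.
  have uv : u != v by apply: contraNneq uvj => ->.
  pose w j := (B u j + B v j) / 2.
  pose C : 'M[R]_16 := \matrix_(i, j) set_row (set_row B u w) v w i j.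
  have Cmax : maximizer C := maximizer_average Bmax uv.
  have [KC Cm] := Cmax.
  have PC : Phi C = Phi A.
    by apply/eqP; rewrite eq_le Am //= -PB Cm.
  have lC k : C l k = A l k.
    by rewrite mxE /set_row eq_sym (negPf vl) eq_sym (negPf ul) lB.
  have := Bmin C KC; rewrite (iffRL (gP C)) // => /(_ erefl).
  rewrite /f lerN2 => H.
  have vu : v != u by rewrite eq_sym.
  have CE i k : C i k = set_row (set_row B u w) v w i k by rewrite mxE.
  have : \sum_i \sum_k B i k ^+ 2 - \sum_i \sum_k C i k ^+ 2 =
      \sum_k (B u k - B v k) ^+ 2 / 2.
    have D2 (F : 'I_16 -> R) :
        \sum_i F i = F u + (F v + \sum_(i | (i != u) && (i != v)) F i).
      by rewrite (bigD1 u) //= (bigD1 v).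
    rewrite (D2 (fun i => \sum_k B i k ^+ 2)) (D2 (fun i => \sum_k C i k ^+ 2)).
    rewrite [X in _ - (_ + (_ + X))](eq_bigr (fun i => \sum_k B i k ^+ 2)); last first.
      move=> i /andP[/negPf iu /negPf iv]; apply: eq_bigr => k _.
      by rewrite CE /set_row iv iu.
    rewrite [LHS](_ : _ = \sum_k B u k ^+ 2 + \sum_k B v k ^+ 2
      - (\sum_k C u k ^+ 2 + \sum_k C v k ^+ 2)); last by ring.
    rewrite -!big_split /= -sumrB.
    by apply: eq_bigr => k _; rewrite !CE /set_row !eqxx (negPf uv) /w; field.
  have S1 : 0 < \sum_k (B u k - B v k) ^+ 2 / 2.
    rewrite (bigD1 j) //=; apply: ltr_pwDl.
      by rewrite divr_gt0 // lt_def sqr_ge0 sqrf_eq0 subr_eq0 uvj.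
    by apply: sumr_ge0 => k _; rewrite divr_ge0 ?sqr_ge0.
  by move: S1 H; move: (\sum_i \sum_k B i k ^+ 2) (\sum_i \sum_k C i k ^+ 2) => x y; lra.
have [rB cB pB mB] := maximizer_doubly_stochastic Bmax.
have [u ul] : exists u, u != l.
  have [->|l0] := eqVneq l ord0; first by exists ord_max.
  by exists ord0; rewrite eq_sym.
have Bu i j : i != l -> B i j = B u j by move=> il; exact: rows_eq.
have bc := common_row_const Bu pB (rB u) (mB l).
have bE j : B u j = 1 / 16.
  have := rB u; rewrite /rowsum (eq_bigr (fun=> B u j)) => [|k _]; last exact: bc.
  by rewrite sumr_const card_ord -mulr_natl => E; lra.
move=> j; rewrite -lB.
have := cB j; rewrite /colsum (bigD1 l) //= (eq_bigr (fun=> 1 / 16)) => [|i il]; last first.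
  by rewrite Bu.
rewrite sumr_const (_ : #|_| = 15%N).
  by rewrite -mulr_natl => E; lra.
by have := cardC1 l; rewrite card_ord.
Qed.

End Maximizers.

Theorem theorem1p1 (R : realType) (A : 'M[R]_16) (hA : K A) :
  Phi A <= 2 - (16`!)%:R / 16 ^+ 16 /\
  (Phi A = 2 - (16`!)%:R / 16 ^+ 16 <-> A = U R 16).
Proof.
have maxU B : maximizer B -> B = U R 16.
  by move=> Bmax; apply/matrixP => i j; rewrite mxE maximizer_row_uniform.
have [B [KB _ Bm]] := K_extreme_value (@mx_continuous_Phi R 16)
  (@mx_continuous_cst R 16 0) hA erefl.
have Bmax : maximizer B by split=> // C KC; exact: Bm.
have BU := maxU B Bmax; rewrite BU in Bm.
rewrite -Phi_uniform; split; first exact: Bm.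
split=> [E|->//]; apply: maxU; split=> // C KC.
by rewrite E; exact: Bm.
Qed.
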